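(* Let $m\ge1$. For $t>0$ set $\vec{\bm{c}}_0(t)=((1,1+t),\dots,(1,1+t))$ and $\vec{\bm{c}}_1(t)=((-1,1+t),\dots,(-1,1+t))$, both in $\mathcal{C}^m$. Let $f$ be a spherical polynomial on $\mathbb{R}^{2m}$, let $\vec{\bm{a}}=(\bm{a}_1,\dots,\bm{a}_m)\in\mathbb{R}^{2m}$ satisfy $B_1((1,1),\bm{a}_j)\notin\mathbb{Z}$ and $B_1((-1,1),\bm{a}_j)\notin\mathbb{Z}$ for all $1\le j\le m$, and let $\vec{\bm{b}}\in\mathbb{R}^{2m}$. Then for $\tau\in\mathbb{H}$, $$\lim_{t\to0}\theta^{\vec{\bm{c}}_0(t),\vec{\bm{c}}_1(t)}_{\vec{\bm{a}},\vec{\bm{b}}}[f](\tau)=\sum_{\vec{\bm{x}}\in\vec{\bm{a}}+\mathbb{Z}^{2m}}\prod_{j=1}^m\big(\operatorname{sgn}(x_j-y_j)-\operatorname{sgn}(-x_j-y_j)\big)f(\vec{\bm{x}})q^{Q_m(\vec{\bm{x}})}e^{2\pi iB_m(\vec{\bm{x}},\vec{\bm{b}})},$$ the right-hand side converging absolutely. In particular, for $\vec{\bm{a}}=((0,\frac12),\dots,(0,\frac12))$, $\vec{\bm{b}}=((\frac12,\frac12),\dots,(\frac12,\frac12))$ and $f=V_m$, $$\lim_{t\to0}\theta^{\vec{\bm{c}}_0(t),\vec{\bm{c}}_1(t)}_{\vec{\bm{a}},\vec{\bm{b}}}[V_m](\tau)=(4i)^m\,m!\Big(\prod_{j=1}^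m(2j-1)!\Big)^2\mathrm{KW}_m(\tau).$$
   Context: $\tau=u+iv\in\mathbb{H}$, $q^c=e^{2\pi ic\tau}$. Write $\vec{\bm{x}}=(\bm{x}_1,\dots,\bm{x}_m)\in\mathbb{R}^{2m}$, $\bm{x}_j=(x_j,y_j)$. $Q_1(x,y)=\frac12(x^2-y^2)$, $B_1((x,y),(x',y'))=xx'-yy'$, $Q_m(\vec{\bm{x}})=\sum_jQ_1(\bm{x}_j)$, $B_m(\vec{\bm{x}},\vec{\bm{y}})=\sum_jB_1(\bm{x}_j,\bm{y}_j)$. $\Delta_m=\sum_j(\partial_{x_j}^2-\partial_{y_j}^2)$; a polynomial is spherical of degree $d$ if homogeneous of degree $d$ and annihilated by $\Delta_m$. $\mathcal{C}=\{(x,y)\in\mathbb{R}^2\mid Q_1(x,y)<0,\ y>0\}$, $E(z)=2\int_0^ze^{-\pi u^2}du$, and for $\bm{c}=(c_1,c_2)\in\mathcal{C}$, $\partial_{\bm{c}}(\bm{x})=\frac{1}{\sqrt{-Q_1(\bm{c})}}(c_1\partial_x+c_2\partial_y)$. For $\vec{\bm{c}}_0=(\bm{c}^{(0)}_j)_j,\vec{\bm{c}}_1=(\bm{c}^{(1)}_j)_j\in\mathcal{C}^m$ and $f$ of degree $d$, $$p^{\vec{\bm{c}}_0,\vec{\bm{c}}_1}[f](\vec{\bm{x}})=\sum_{\vec\sigma\in\{0,1\}^m}(-1)^{|\vec\sigma|}\sum_{k=0}^d\frac{(-1)^k}{(4\pi)^k}\sum_{\substack{\vec k\in(\mathbb{Z}_{\ge0})^m\\|\vec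 k|=k}}\prod_{j=1}^m\frac{1}{k_j!}E^{(k_j)}\Big(\frac{B_1(\bm{c}_j^{(\sigma_j)},\bm{x}_j)}{\sqrt{-Q_1(\bm{c}_j^{(\sigma_j)})}}\Big)\cdot\Big(\prod_{j=1}^m\partial_{\bm{c}_j^{(\sigma_j)}}(\bm{x}_j)^{k_j}\Big)f(\vec{\bm{x}})$$ ($|\vec v|=v_1+\cdots+v_m$), and $\theta^{\vec{\bm{c}}_0,\vec{\bm{c}}_1}_{\vec{\bm{a}},\vec{\bm{b}}}[f](\tau)=v^{-d/2}\sum_{\vec{\bm{x}}\in\vec{\bm{a}}+\mathbb{Z}^{2m}}p^{\vec{\bm{c}}_0,\vec{\bm{c}}_1}[f](\vec{\bm{x}}\sqrt v)q^{Q_m(\vec{\bm{x}})}e^{2\pi iB_m(\vec{\bm{x}},\vec{\bm{b}})}$. Further, $V_m(\vec{\bm{x}})=\prod_{1\le i<j\le m}(x_i^2-x_j^2)(y_i^2-y_j^2)\prod_jx_jy_j$ and $$\mathrm{KW}_m(\tau)=\frac{1}{4^m}\frac{1}{m!\left(\prod_{j=1}^m(2j-1)!\right)^2}\sum_{\substack{x_1,\dots,x_m\in\mathbb{Z}\\ y_1,\dots,y_m\in\frac12+\mathbb{Z}}}\prod_{j=1}^m\big(\operatorname{sgn}(x_j-y_j)-\operatorname{sgn}(-x_j-y_j)\big)V_m(\vec{\bm{x}})\prod_{j=1}^mq^{\frac12(x_j^2-y_j^2)}(-1)^{x_j-y_j-1/2}.$$ $\operatorname{sgn}$ is the sign function (its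 arguments are nonzero under the hypotheses). *)

(* Defs.v *)
From HB Require Import structures.
From mathcomp Require Import all_boot all_order all_algebra.
(* The grammar of mpoly is rejected once that of mathcomp-analysis is loaded,
   but not the other way round, so mpoly has to be imported first. *)
From mathcomp Require Import mpoly.
From mathcomp Require Import complex.
From mathcomp Require Import all_classical all_reals all_analysis.
From mathcomp.analysis Require showcase.summability.

Set Implicit Arguments.
Unset Strict Implicit.
Unset Printing Implicit Defensive.

Import Order.TTheory GRing.Theory Num.Theory.
Import numFieldNormedType.Exports.

Local Open Scope classical_set_scope.
Local Open Scope complex_scope.
Local Open Scope ring_scope.

Section Definitions.
Context {R : realType}.

(* Topological statements about complex numbers go through R[i]^o, where the
   library puts the topology of the complex modulus. *)

Section InfiniteSums.
Context {I : choiceType}.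

Definition abs_summable (F : I -> R[i]) : Prop :=
  esum.summable [set: I] (fun i => (complex.Re `|F i|)%:E).

(* Unordered sum: limit of the finite partial sums along finite subsets of I;
   unspecified if these do not converge. *)
Definition csum (F : I -> R[i]) : R[i]^o :=
  summability.sum (F : I -> R[i]^o).

End InfiniteSums.

Definition cexp (z : R[i]) : R[i] :=
  (expR (complex.Re z))%:C
    * (cos (complex.Im z) +i* sin (complex.Im z)).

(* q^c = e^{2 pi i c tau} for real c *)
Definition qpow (tau : R[i]) (c : R) : R[i] :=
  cexp ((2 * pi * c)%:C * 'i%C * tau).

Definition Q1 (x : R * R) : R := 2^-1 * (x.1 ^+ 2 - x.2 ^+ 2).

Definition B1 (x y : R * R) : R := x.1 * y.1 - x.2 * y.2.

Definition cone : set (R * R) := [set c | Q1 c < 0 /\ 0 < c.2].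

Definition gauss (u : R) : R := expR (- (pi * u ^+ 2)).

(* E(z) = 2 \int_0^z e^{-pi u^2} du with the oriented integral *)
Definition E (z : R) : R :=
  2 * (if 0 <= z then \int[lebesgue_measure]_(u in `[0, z]) gauss u
       else - \int[lebesgue_measure]_(u in `[z, 0]) gauss u).

Section Rank.
Context {m : nat}.

Implicit Types (x y a b c : 'I_m -> R * R).

(* Polynomial functions R^{2m} -> C. Variable lshift m j is x_j, variable
   rshift m j is y_j. *)
Implicit Types (f : {mpoly R[i][(m + m)%N]}).

Definition Qm x : R := \sum_j Q1 (x j).

Definition Bm x y : R := \sum_j B1 (x j) (y j).

Definition coords x (k : 'I_(m + m)) : R[i] :=
  match fintype.split k with
  | inl j => ((x j).1)%:C
  | inr j => ((x j).2)%:C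
  end.

Definition evalp f x : R[i] := f.@[coords x].

Definition Dx (j : 'I_m) f : {mpoly R[i][(m + m)%N]} := f^`M(lshift m j).

Definition Dy (j : 'I_m) f : {mpoly R[i][(m + m)%N]} := f^`M(rshift m j).

Definition Laplace f : {mpoly R[i][(m + m)%N]} :=
  \sum_(j < m) (Dx j (Dx j f) - Dy j (Dy j f)).

Definition spherical (d : nat) f : Prop :=
  f \is d.-homog for mdeg /\ Laplace f = 0.

Definition degree f : nat := (msize f).-1.

(* \partial_c(x_j) *)
Definition Dc (c : R * R) (j : 'I_m) f : {mpoly R[i][(m + m)%N]} :=
  ((Num.sqrt (- Q1 c))^-1)%:C *: (c.1%:C *: Dx j f + c.2%:C *: Dy j f).

(* \prod_j \partial_{c_j}(x_j)^{k_j}, the product being composition *)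
Definition Dcs c (k : 'I_m -> nat) : {mpoly R[i][(m + m)%N]} -> _ :=
  \big[(fun F G => F \o G)/id]_(j < m) iter (k j) (Dc (c j) j).

Definition pfun (c0 c1 : 'I_m -> R * R) f x : R[i] :=
  \sum_(s : {ffun 'I_m -> bool})
    let c (j : 'I_m) := if s j then c1 j else c0 j in
    (-1) ^+ (\sum_j s j)%N *
    \sum_(0 <= k < (degree f).+1)
      ((-1) ^+ k / (4 * pi) ^+ k)%:C *
      \sum_(kv : {ffun 'I_m -> 'I_k.+1} | (\sum_j kv j == k)%N)
        (\prod_j (((kv j)`!)%:R^-1
                  * derive1n (kv j) E (B1 (c j) (x j) / Num.sqrt (- Q1 (c j)))))%:C
        * evalp (Dcs c (fun j => kv j) f) x.

(* the point a + n of the shifted lattice a + Z^{2m} *)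
Definition latt a (n : {ffun 'I_m -> int * int}) (j : 'I_m) : R * R :=
  ((a j).1 + (n j).1%:~R, (a j).2 + (n j).2%:~R).

Definition scalev (r : R) x (j : 'I_m) : R * R := (r * (x j).1, r * (x j).2).

Definition theta (c0 c1 : 'I_m -> R * R) a b f (tau : R[i]) : R[i]^o :=
  let v := complex.Im tau in
  (v `^ (- ((degree f)%:R / 2)))%:C *
  csum (fun n : {ffun 'I_m -> int * int} =>
    let x := latt a n in
    pfun c0 c1 f (scalev (Num.sqrt v) x) * qpow tau (Qm x)
      * cexp ((2 * pi * Bm x b)%:C * 'i%C)).

Definition sgnprod x : R :=
  \prod_j (Num.sg ((x j).1 - (x j).2) - Num.sg (- (x j).1 - (x j).2)).

Definition sgn_term a b f (tau : R[i]) (n : {ffun 'I_m -> int * int}) : R[i] :=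
  let x := latt a n in
  (sgnprod x)%:C * evalp f x * qpow tau (Qm x)
    * cexp ((2 * pi * Bm x b)%:C * 'i%C).

End Rank.

Definition Vpoly (m : nat) : {mpoly R[i][(m + m)%N]} :=
  let X (j : 'I_m) : {mpoly R[i][(m + m)%N]} := 'X_(lshift m j) in
  let Y (j : 'I_m) : {mpoly R[i][(m + m)%N]} := 'X_(rshift m j) in
  (\prod_(i < m) \prod_(j < m | (i < j)%N)
     ((X i ^+ 2 - X j ^+ 2) * (Y i ^+ 2 - Y j ^+ 2)))
  * \prod_(j < m) (X j * Y j).

(* The summation indices are x_j = (n j).1 and y_j = (n j).2 + 1/2, so that
   x_j - y_j - 1/2 is the integer (n j).1 - (n j).2 - 1. *)
Definition KW (m : nat) (tau : R[i]) : R[i]^o :=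
  (4 ^+ m)^-1 * ((m`!)%:R * (\prod_(1 <= j < m.+1) ((2 * j - 1)`!)%:R) ^+ 2)^-1 *
  csum (fun n : {ffun 'I_m -> int * int} =>
    let x (j : 'I_m) : R * R := ((n j).1%:~R, (n j).2%:~R + 2^-1) in
    (sgnprod x)%:C * evalp (Vpoly m) x *
    \prod_j (qpow tau (2^-1 * ((x j).1 ^+ 2 - (x j).2 ^+ 2))
             * (-1) ^ ((n j).1 - (n j).2 - 1))).

Definition c0vec (m : nat) (t : R) (j : 'I_m) : R * R := (1, 1 + t).

Definition c1vec (m : nat) (t : R) (j : 'I_m) : R * R := (-1, 1 + t).

End Definitions.

(* Main.v *)
Require Import Defs.
From HB Require Import structures.
From mathcomp Require Import all_boot all_order all_algebra.
From mathcomp Require Import mpoly.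
From mathcomp Require Import finmap complex.
From mathcomp Require Import all_classical all_reals all_analysis.
From mathcomp Require Import measurable_realfun.
From mathcomp Require Import ring lra.

Set Implicit Arguments.
Unset Strict Implicit.
Unset Printing Implicit Defensive.

Import Order.TTheory GRing.Theory Num.Theory.
Import numFieldNormedType.Exports.

Local Open Scope classical_set_scope.
Local Open Scope complex_scope.
Local Open Scope ring_scope.

(* Expanding f into monomials x^a y^b, the alternating sum over sigma factors
   over the m variables, and the factor of one variable is a difference of
   terms E^(l)(z) * (\partial_c^l x^a y^b). For c = (1, 1 + t), with p = x - y
   and r = x + y, one has z^2 + p r >= p^2 / (2 t) + |p r| / 2, so the weight
   e^{- pi (x^2 - y^2)} times the Gaussian e^{- pi z^2} is at most
   e^{- pi p^2 / (2 t)} e^{- pi |p r| / 2}. On the shifted lattice |p| and |r|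
   are bounded below, so this beats all powers of 1/t and of |x| + |y|: the
   terms l > 0 are O(t e^{- k (|x| + |y|)}), and so is E(z) - sgn p for l = 0,
   because |E(z) - sgn z| <= e^{- pi z^2} and, when z and p have opposite
   signs, p r > p^2 / t. The vector (-1, 1 + t) reduces to (1, 1 + t) by
   x -> -x. Hence every term of the theta series is within O(t) of its limit
   with a summable constant. *)

(** * The error function E *)

(** The form Q_1 is indefinite: the weight e^{- pi p r} grows where p r < 0, so neither sign alone
    gives a summable term. The difference sgn(p) - sgn(- r) vanishes there, and where p r > 0 the
    lower bound d on |p| and |r| turns p r into a multiple of |x| + |y|; this bounds the limit
    terms, separately from the O(t) estimate. The bound d is the distance from B_1((1,1), a_j) and
    B_1((-1,1), a_j) to the integers, scaled by sqrt v. Powers of 1/t arise because sqrt(- Q_1(c)) =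
    sqrt(t (1 + t/2)) tends to 0 and is the denominator both of z and of each \partial_c. An
    explicit rate t, with one majorant for the limit and for the error, is stable under products
    over the variables and under the finite sums over monomials and derivative orders, and it
    reduces the exchange of limit and series to one inequality. Homogeneity of f turns evaluation at
    x sqrt v into the factor that v^{-d/2} cancels. *)

Section E.
Context {R : realType}.
Local Notation mu := (@lebesgue_measure R).

Lemma gauss_ge0 (x : R) : 0 <= gauss x.
Proof. exact: expR_ge0. Qed.

Lemma gaussN (x : R) : gauss (- x) = gauss x.
Proof. by rewrite /gauss sqrrN. Qed.

#[local] Instance is_derive_gauss (x : R) :
  is_derive x 1 gauss (- (2 * pi * x) * gauss x).
Proof.
rewrite /gauss; apply: is_derive_eq.
by rewrite /GRing.scale /=; ring.
Qed.

Lemma continuous_gauss : continuous (@gauss R).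
Proof.
by move=> x; apply: differentiable_continuous; apply/derivable1_diffP; apply: ex_derive.
Qed.

(** Comparison with e^{-x^2}, as pi >= 1. *)
Lemma integrable_gauss (D : set R) : measurable D ->
  mu.-integrable D (EFin \o gauss).
Proof.
move=> mD; apply: (@integrableS _ _ _ mu setT) => //.
apply: (le_integrable measurableT _ _ integrableT_gauss).
  apply/measurable_EFinP; apply: continuous_measurable_fun.
  exact: continuous_gauss.
move=> x _ /=; rewrite lee_fin !ger0_norm ?expR_ge0// ler_expR lerN2.
by rewrite ler_peMl ?sqr_ge0// (le_trans _ (pi_ge2 R))// ler1n.
Qed.

(** Replaces the case split at 0 in [E] by one formula with a base point on the left, to which the
    fundamental theorem of calculus applies. *)
Lemma E_itv (L z : R) : L <= 0 -> L <= z ->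
  E z = 2 * (\int[mu]_(u in `[L, z]) gauss u - \int[mu]_(u in `[L, 0]) gauss u).
Proof.
move=> L0 Lz; rewrite /E; congr (2 * _).
have split3 (a b c : R) : a <= b -> b <= c ->
    \int[mu]_(u in `[b, c]) gauss u
    = \int[mu]_(u in `[a, c]) gauss u - \int[mu]_(u in `[a, b]) gauss u.
  move=> ab bc; rewrite Rintegral_itvB ?bnd_simp//; last exact: integrable_gauss.
  by rewrite Rintegral_itv_obnd_cbnd//; exact: integrable_gauss.
case: ifPn => [z0|]; first exact: split3.
by rewrite -ltNge => /ltW z0; rewrite (split3 L z 0)// opprB.
Qed.


#[local] Instance is_derive_E (x : R) : is_derive x 1 E (2 * gauss x).
Proof.
(* Strictly left of x and of 0, so that [E_itv] holds in a neighbourhood of x. *)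
pose L : R := Num.min x 0 - 1.
have [Lx L0] : L < x /\ L < 0.
  by rewrite /L; split; rewrite ltrBlDr ltr_pwDr// ge_min lexx ?orbT.
pose F (y : R) := \int[mu]_(u in `[L, y]) gauss u.
have [dF F'] : derivable F x 1 /\ derive1 F x = gauss x.
  apply: (@continuous_FTC1_closed _ _ L x (x + 1)) => //.
  - by rewrite ltrDl.
  - exact: integrable_gauss.
  - exact: continuous_gauss.
have dF1 : is_derive x 1 F (gauss x).
  by apply: DeriveDef; [exact: dF|rewrite -derive1E].
have : is_derive x 1 (fun y => 2 * (F y - \int[mu]_(u in `[L, 0]) gauss u)) (2 * gauss x).
  by apply: is_derive_eq; rewrite /= subr0.
apply: near_eq_is_derive => //.
near=> y; rewrite /F -E_itv// ltW//.
near: y; exact: lt_nbhsr.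
Unshelve. all: by end_near. Qed.

Lemma E0 : E 0 = 0 :> R.
Proof. by rewrite /E lexx set_itv1 Rintegral_set1 mulr0. Qed.

Lemma derivable_E (x : R) : derivable (E : R -> R) x 1.
Proof. exact: ex_derive. Qed.

Lemma continuous_E : continuous (@E R).
Proof.
by move=> x; apply: differentiable_continuous; apply/derivable1_diffP; exact: derivable_E.
Qed.

Lemma E_nondecreasing : {homo @E R : x y / x <= y}.
Proof.
move=> x y xy; apply: (@ger0_derive1_le_cc _ E x y) => //; rewrite ?in_itv/= ?lexx ?xy//.
- by move=> z _; rewrite derive1E derive_val mulr_ge0 ?gauss_ge0.
- by apply: continuous_subspaceT; exact: continuous_E.
Qed.

Lemma EN (x : R) : E (- x) = - E x.
Proof.
apply/eqP; rewrite -addr_eq0; apply/eqP.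
have d0 (y : R) : is_derive y 1 (fun y : R => E (- y) + E y : R) 0.
  apply: is_derive_eq; rewrite /= gaussN; ring.
have := is_derive_0_is_cst x 0 d0.
by rewrite /= oppr0 E0 addr0.
Qed.

Lemma E_le_integral (x : R) : E x <= 2 * \int[mu]_u gauss u.
Proof.
rewrite (@le_trans _ _ (E (Num.max x 0)))//.
  by apply: E_nondecreasing; rewrite le_max lexx.
rewrite /E le_max lexx orbT ler_pM2l//.
apply: fine_le; [exact: integrable_fin_num (integrable_gauss _)..|].
apply: ge0_subset_integral => //.
  by apply/measurable_EFinP; apply: continuous_measurable_fun; exact: continuous_gauss.
by move=> u _; rewrite lee_fin gauss_ge0.
Qed.

Lemma cvg_E_sup : E x @[x --> +oo%R] --> sup (range (@E R)).
Proof.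
apply: nondecreasing_cvgr; first exact: E_nondecreasing.
by exists (2 * \int[mu]_u gauss u) => _ [x _ <-]; exact: E_le_integral.
Qed.

(** E(x / sqrt pi) has derivative 2 / sqrt pi times e^{-x^2}, whose integral over the half line is
    1. *)
Lemma sup_range_E : sup (range E) = 1 :> R.
Proof.
have sp0 : 0 < Num.sqrt (pi : R) by rewrite sqrtr_gt0 pi_gt0.
have sp2 : Num.sqrt (pi : R) ^+ 2 = pi by rewrite sqr_sqrtr// pi_ge0.
pose f (x : R) := 2 / Num.sqrt pi * gauss_fun x.
pose F (x : R) : R := E (x / Num.sqrt pi).
have dF (x : R) : is_derive x 1 F (f x).
  apply: is_derive_eq; rewrite /f /gauss /gauss_fun /= expr_div_n sp2.
  rewrite mulrCA divff ?gt_eqF ?pi_gt0// mulr1 scaler1 [_ *: _]mulrC. by rewrite mul0r add0r mulrAC.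
have := @ge0_continuous_FTC2y R f F 0 (sup (range (@E R))).
have -> : F 0 = 0 by rewrite /F mul0r E0.
rewrite sube0.
under eq_integral do rewrite EFinM.
rewrite ge0_integralZl//=; last 2 first.
- by apply/measurable_EFinP/measurable_funTS; exact: measurable_gauss_fun.
- by move=> x _; rewrite lee_fin gauss_fun_ge0.
rewrite integral0y_gauss -EFinM mulrA divfK ?gt_eqF// divff// => H.
apply/esym/EFin_inj/H.
- by move=> x _; rewrite mulr_ge0 ?gauss_fun_ge0// divr_ge0// ltW.
- apply: continuous_subspaceT => x; apply: cvgM; [exact: cvg_cst|exact: continuous_gauss_fun].
- rewrite /F; apply: cvg_comp cvg_E_sup => /=.
  by apply: gt0_cvgMly; [rewrite invr_gt0| exact: cvg_id].
- by move=> x _; exact: ex_derive.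
- have F0 : F 0 = 0 by rewrite /F mul0r E0.
  rewrite -[X in _ --> X]F0; apply: cvg_at_right_filter.
  apply: differentiable_continuous; apply/derivable1_diffP; exact: ex_derive.
- by move=> x _; rewrite derive1E derive_val.
Qed.

Lemma E_le1 (x : R) : E x <= 1.
Proof.
rewrite -sup_range_E; apply: ub_le_sup; last by exists x.
by exists (2 * \int[mu]_u gauss u) => _ [y _ <-]; exact: E_le_integral.
Qed.

Lemma normr_E_le1 (x : R) : `|E x| <= 1.
Proof. by rewrite ler_norml E_le1 lerNl -EN E_le1. Qed.

(* (z + w)^2 >= z^2 + w^2, so the increments of E on [z, +oo[ are at most
   gauss z times those on [0, +oo[ *)
Lemma E_tail (z : R) : 0 <= z -> `|E z - 1| <= gauss z.
Proof.
move=> z0; rewrite ler0_norm ?subr_le0 ?E_le1// opprB.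
have inc (w : R) : 0 <= w -> E (z + w) - E z <= gauss z.
  move=> w0.
  pose h (y : R) : R := gauss z * E y - E (z + y).
  have dh (y : R) : is_derive y 1 h (gauss z * (2 * gauss y) - 2 * gauss (z + y)).
    apply: is_derive_eq; by rewrite /= add0r mulr1.
  have : h 0 <= h w.
    apply: (@ger0_derive1_le_cc _ h 0 w) => //; rewrite ?in_itv/= ?lexx ?w0//.
    - move=> y; rewrite in_itv/= => /andP[/ltW y0 _].
      rewrite derive1E derive_val subr_ge0 mulrCA ler_pM2l// /gauss -expRD ler_expR.
      rewrite -opprD lerN2 -mulrDr ler_wpM2l ?pi_ge0//.
      by rewrite sqrrD -addrA [_ *+ _ + _]addrC addrA lerDl mulrn_wge0 ?mulr_ge0.
    - apply: continuous_subspaceT => y.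
      by apply: differentiable_continuous; apply/derivable1_diffP; exact: ex_derive.
  rewrite /h E0 addr0 mulr0 sub0r => H.
  rewrite (@le_trans _ _ (gauss z * E w))//; first by lra.
  by rewrite ler_piMr ?gauss_ge0 ?E_le1.
rewrite lerBlDr -sup_range_E; apply: ge_sup; first by exists (E 0), 0.
move=> _ [x _ <-]; have [zx|/ltW xz] := leP z x.
  by rewrite -lerBlDr -(subrKC z x) inc// subr_ge0.
by rewrite (le_trans (E_nondecreasing xz))// lerDr gauss_ge0.
Qed.

(** Differentiating P gauss gives (P' - 2 pi X P) gauss. Later only the polynomial growth of P
    enters, so P stays existential. *)
Lemma derive1n_E (l : nat) : exists P : {poly R},
  forall z, derive1n l.+1 E z = P.[z] * gauss z.
Proof.
elim: l => [|l [P IH]].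
  exists 2%:P => z; rewrite derive1n1 derive1E derive_val hornerC//.
exists (P^`() - (2 * pi) *: ('X * P)) => z.
rewrite derive1nS (_ : derive1n l.+1 E = fun z => P.[z] * gauss z); last exact/funext.
rewrite derive1E derive_val !hornerE /GRing.scale /=; ring.
Qed.
End E.

(** * Unordered sums of complex numbers *)

Section Modulus.
Context {R : realType}.
Implicit Types z w : R[i].

(** The modulus as a real number; the norm of [R[i]] takes its values in [R[i]]. *)
Definition cmod z : R := complex.Re `|z|.

Lemma cmodE z : `|z| = (cmod z)%:C.
Proof. by rewrite /cmod normc_def. Qed.

Lemma cmod_ge0 z : 0 <= cmod z.
Proof. by rewrite -lecR -cmodE normr_ge0. Qed.

Lemma cmodM z w : cmod (z * w) = cmod z * cmod w.
Proof. by apply: complexI; rewrite rmorphM -!cmodE normrM. Qed.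

Lemma cmodD z w : cmod (z + w) <= cmod z + cmod w.
Proof. by rewrite -lecR rmorphD -!cmodE ler_normD. Qed.

Lemma cmodR (x : R) : cmod x%:C = `|x|.
Proof. by rewrite /cmod normc_def /= expr0n /= addr0 sqrtr_sqr. Qed.

Lemma cmod_sum (J : Type) (r : seq J) (P : pred J) (F : J -> R[i]) :
  cmod (\sum_(j <- r | P j) F j) <= \sum_(j <- r | P j) cmod (F j).
Proof.
rewrite -lecR -cmodE raddf_sum (le_trans (ler_norm_sum _ _ _))//.
Qed.

Lemma normr_Re_le z : `|complex.Re z| <= cmod z.
Proof. by rewrite -lecR -cmodE normc_ge_Re. Qed.

Lemma normr_Im_le z : `|complex.Im z| <= cmod z.
Proof.
have := normr_Re_le (z * 'i%C).
rewrite ReiNIm normrN cmodM [cmod 'i%C]/cmod normc_def /= expr0n expr1n add0r sqrtr1.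
by rewrite mulr1.
Qed.

Lemma cmod_le_ReIm z : cmod z <= `|complex.Re z| + `|complex.Im z|.
Proof.
rewrite [z in X in X <= _]complexE (le_trans (cmodD _ _))// cmodM !cmodR.
by rewrite [cmod 'i%C]/cmod normc_def /= expr0n expr1n add0r sqrtr1 mul1r.
Qed.

End Modulus.

Section UnorderedSums.
#[local] Existing Instance summability.totally_filter.
Context {R : realType} {I : choiceType}.
Local Notation psum := (@summability.partial_sum I _).
Local Notation totally := (@summability.totally I).

Lemma psumE (V : zmodType) (F : I -> V) (A : {fset I}) :
  psum F A = \sum_(i <- A) F i.
Proof. by rewrite /summability.partial_sum big_seq_fsetE. Qed.

Lemma ler_psum (F : I -> R) (A B : {fset I}) :
  (forall i, 0 <= F i) -> (A `<=` B)%fset -> psum F A <= psum F B.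
Proof.
move=> F0 AB; rewrite !psumE [leRHS](bigID (fun i => i \in A))/=.
rewrite (_ : \sum_(i <- A) F i = \sum_(i <- B | i \in A) F i).
  by rewrite lerDl sumr_ge0.
rewrite -[RHS]big_filter; apply: perm_big; apply: uniq_perm.
- exact: fset_uniq.
- by rewrite filter_uniq// fset_uniq.
- move=> i; rewrite mem_filter.
  by have [iA|//] := boolP (i \in A); rewrite (fsubsetP AB).
Qed.

Lemma nneg_psum_cvg (F : I -> R) (M : R) : (forall i, 0 <= F i) ->
  (forall A, psum F A <= M) -> cvg (psum F @ totally).
Proof.
move=> F0 FM; apply/cvg_ex; exists (sup (range (psum F))).
have hsF : has_sup (range (psum F)).
  by split; [exists (psum F fset0), fset0|exists M => _ [A _ <-]].
apply/cvgrPdist_le => e e0.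
have [_ [A _ <-] Ae] := sup_adherent e0 hsF.
exists A => // B /= AB.
rewrite ger0_norm ?subr_ge0; last by apply: (ub_le_sup hsF.2); exists B.
by rewrite lerBlDl -lerBlDr (le_trans (ltW Ae))// ler_psum.
Qed.

(** F = |F| - (|F| - F), where both parts are nonnegative, with partial sums at most M and 2 M. *)
Lemma real_psum_cvg (F : I -> R) (M : R) :
  (forall A, psum (fun i => `|F i|) A <= M) -> cvg (psum F @ totally).
Proof.
move=> FM.
rewrite (_ : psum F = psum (fun i => `|F i|) \- psum (fun i => `|F i| - F i)); last first.
  apply/funext => A /=; rewrite !psumE -sumrB; apply: eq_bigr => i _; ring.
apply: is_cvgB; first by apply: nneg_psum_cvg FM.
apply: (@nneg_psum_cvg _ (2 * M)) => [i|A]; first by rewrite subr_ge0 ler_norm.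
rewrite mulr_natl mulr2n; apply: le_trans (lerD (FM A) (FM A)).
rewrite !psumE -big_split /=; apply: ler_sum => i _.
by rewrite lerD2l -normrN ler_norm.
Qed.

(* [R[i]^o] has no complete structure, hence the detour through real and
   imaginary parts. *)
Lemma csum_cvg (F : I -> R[i]) (M : R) :
  (forall A, psum (fun i => cmod (F i)) A <= M) ->
  psum (F : I -> R[i]^o) @ totally --> csum F.
Proof.
move=> FM.
have /cvg_ex[/= a /cvgrPdist_le Ra] : cvg (psum (fun i => complex.Re (F i)) @ totally).
  apply: (@real_psum_cvg _ M) => A; apply: le_trans (FM A).
  by rewrite !psumE ler_sum// => i _; exact: normr_Re_le.
have /cvg_ex[/= b /cvgrPdist_le Rb] : cvg (psum (fun i => complex.Im (F i)) @ totally).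
  apply: (@real_psum_cvg _ M) => A; apply: le_trans (FM A).
  by rewrite !psumE ler_sum// => i _; exact: normr_Im_le.
suff h : psum (F : I -> R[i]^o) @ totally --> ((a +i* b)%C : R[i]^o).
  by apply/cvg_ex; exists (a +i* b)%C.
apply/cvgrPdist_le => e e0.
have eE : e = (complex.Re e)%:C by rewrite RRe_real// gtr0_real.
have re0 : 0 < complex.Re e / 2 by rewrite divr_gt0// -ltcR -eE.
near=> A.
rewrite eE cmodE lecR (le_trans (cmod_le_ReIm _))// [leRHS]splitr.
rewrite !raddfB /=.
have -> : complex.Re (psum (F : I -> R[i]^o) A) = psum (fun i => complex.Re (F i)) A.
  by rewrite !psumE raddf_sum.
have -> : complex.Im (psum (F : I -> R[i]^o) A) = psum (fun i => complex.Im (F i)) A.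
  by rewrite !psumE raddf_sum.
by apply: lerD; near: A; [exact: Ra|exact: Rb].
Unshelve. all: by end_near. Qed.

Lemma csum_eq (F : I -> R[i]) (l : R[i]^o) :
  psum (F : I -> R[i]^o) @ totally --> l -> csum F = l.
Proof. by move=> Fl; apply: cvg_lim => //; exact: (@norm_hausdorff _ (R[i]^o)). Qed.

Lemma csumZ (F : I -> R[i]) (M : R) (c : R[i]) :
  (forall A, psum (fun i => cmod (F i)) A <= M) ->
  csum (fun i => c * F i) = c * csum F.
Proof.
move=> FM; apply: csum_eq.
rewrite (_ : psum _ = fun A => (c : R[i]^o) *: psum (F : I -> R[i]^o) A); last first.
  by apply/funext => A; rewrite !psumE scaler_sumr.
by apply: cvgZr; exact: csum_cvg FM.
Qed.

Lemma csumB (F G : I -> R[i]) (M N : R) :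
  (forall A, psum (fun i => cmod (F i)) A <= M) ->
  (forall A, psum (fun i => cmod (G i)) A <= N) ->
  csum (fun i => F i - G i) = csum F - csum G.
Proof.
move=> FM GN; apply: csum_eq.
rewrite (_ : psum _ = psum (F : I -> R[i]^o) \- psum (G : I -> R[i]^o)); last first.
  by apply/funext => A /=; rewrite !psumE sumrB.
by apply: cvgB; [exact: csum_cvg FM|exact: csum_cvg GN].
Qed.

Lemma cmod_csum_le (F : I -> R[i]) (M : R) :
  (forall A, psum (fun i => cmod (F i)) A <= M) -> cmod (csum F) <= M.
Proof.
move=> FM; apply/ler_addgt0Pr => e e0.
have /cvgrPdist_le/(_ e%:C) := csum_cvg FM.
rewrite ltcR => /(_ e0) [A _ /(_ A (fsubset_refl A)) /=].
rewrite cmodE lecR => Ae.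
rewrite -(subrK (psum (F : I -> R[i]^o) A) (csum F)) (le_trans (cmodD _ _))// addrC lerD//.
apply: le_trans (FM A); rewrite !psumE; exact: cmod_sum.
Qed.

Lemma abs_summable_bounded (F : I -> R[i]) (M : R) :
  (forall A, psum (fun i => cmod (F i)) A <= M) -> abs_summable F.
Proof.
move=> FM; rewrite /abs_summable /esum.summable (@le_lt_trans _ _ M%:E)// ?ltry//.
apply: ub_ereal_sup => _ [A [fA _] <-].
have /= -> := fsbig_finite _ _ fA.
rewrite sumEFin.
rewrite lee_fin; apply: le_trans (FM (fset_set A)).
by rewrite psumE ler_sum// => i _; rewrite ger0_norm// cmod_ge0.
Qed.

(** Dominated convergence with a rate: the two sums differ by at most t M. *)
Lemma csum_cvg_at_right (F : R -> I -> R[i]) (F0 : I -> R[i]) (G : I -> R) (M : R) :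
  (forall A, psum G A <= M) -> (forall i, cmod (F0 i) <= G i) ->
  (forall t i, 0 < t <= 1 -> cmod (F t i - F0 i) <= t * G i) ->
  csum (F t) @[t --> 0^'+] --> csum F0.
Proof.
move=> GM F0G FG.
have bdd (H : I -> R[i]) (c : R) : 0 <= c -> (forall i, cmod (H i) <= c * G i) ->
    forall A, psum (fun i => cmod (H i)) A <= c * M.
  move=> c0 HG A; apply: (@le_trans _ _ (c * psum G A)); last by rewrite ler_wpM2l.
  by rewrite !psumE mulr_sumr ler_sum.
have M0 : 0 <= M by apply: le_trans (GM fset0); rewrite psumE big_seq_fset0.
have bF0 := bdd F0 1 ler01.
apply/cvgrPdist_le => e e0.
have eE : e = (complex.Re e)%:C by rewrite RRe_real// gtr0_real.
have re0 : 0 < complex.Re e by rewrite -ltcR -eE.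
near=> t.
have t01 : 0 < t <= 1.
  by apply/andP; split; near: t; [exact: nbhs_right_gt|exact: nbhs_right_le].
have [t0 t1] := andP t01.
have bD := bdd (fun i => F t i - F0 i) t (ltW t0) (fun i => FG t i t01).
(* 2 because |F t i| <= |F0 i| + t G i <= 2 G i. *)
have bF := bdd (F t) 2 (ler0n _ 2).
rewrite distrC -(@csumB _ _ (2 * M) (1 * M)).
- rewrite eE cmodE lecR (le_trans (cmod_csum_le bD))//.
  (* 1 + M is a positive divisor even if M = 0. *)
  rewrite (@le_trans _ _ (t * (1 + M)))//; first by rewrite ler_wpM2l ?lerDr// ltW.
  rewrite -ler_pdivlMr ?ltr_pwDl//; near: t; apply: nbhs_right_le.
  by rewrite divr_gt0// ltr_pwDl.
- apply: bF => i; rewrite -(subrK (F0 i) (F t i)) (le_trans (cmodD _ _))//.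
  rewrite mulr_natl mulr2n lerD// (le_trans (FG _ _ t01))// ler_piMl//.
  exact: le_trans (cmod_ge0 _) (F0G i).
- by apply: bF0 => i; rewrite mul1r.
Unshelve. all: by end_near. Qed.
End UnorderedSums.

(** * Estimates in one variable *)

Section OneVariable.
Context {R : realType}.
Implicit Types (x c : R * R) (t : R).

(** Half of the exponent absorbs y^N by induction, the other half one more y, as c y / 2 <= e^{c y /
    2}. *)
Lemma expr_le_expR (N : nat) (c : R) : 0 < c ->
  exists2 C : R, 0 <= C & forall y, 0 <= y -> y ^+ N <= C * expR (c * y).
Proof.
elim: N c => [|N IH] c c0.
  by exists 1 => // y y0; rewrite expr0 mul1r -expR0 ler_expR mulr_ge0// ltW.
have c20 : 0 < c / 2 by rewrite divr_gt0.
have [C C0 HC] := IH _ c20.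
exists (C * (c / 2)^-1) => [|y y0]; first by rewrite mulr_ge0// invr_ge0 ltW.
have -> : expR (c * y) = expR (c / 2 * y) * expR (c / 2 * y) by rewrite -expRD; congr expR; field.
rewrite exprSr mulrACA; apply: ler_pM => //; [exact: exprn_ge0|exact: HC|].
by rewrite ler_pdivlMl// (le_trans _ (expR_ge1Dx _))// lerDr.
Qed.

Lemma horner_bound (P : {poly R}) :
  exists2 C : R, 0 <= C & forall z, `|P.[z]| <= C * (1 + `|z|) ^+ (size P).
Proof.
exists (\sum_(i < size P) `|P`_i|) => [|z]; first exact: sumr_ge0.
rewrite horner_coef mulr_suml (le_trans (ler_norm_sum _ _ _))//.
apply: ler_sum => i _; rewrite normrM ler_wpM2l// normrX.
rewrite (@le_trans _ _ ((1 + `|z|) ^+ i))//.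
  by rewrite lerXn2r ?nnegrE ?addr_ge0// lerDr.
by apply: ler_weXn2l; [rewrite lerDl|exact/ltnW].
Qed.

(* the value at x of \partial_c^k applied to x^a y^b; when an exponent is 0,
   the junk exponent 0.-1 = 0 comes with the factor 0 *)
Fixpoint Dmono (k : nat) c (a b : nat) x : R :=
  if k is k'.+1 then
    (Num.sqrt (- Q1 c))^-1
      * (c.1 * (a%:R * Dmono k' c a.-1 b x) + c.2 * (b%:R * Dmono k' c a b.-1 x))
  else x.1 ^+ a * x.2 ^+ b.

Definition zarg c x : R := B1 c x / Num.sqrt (- Q1 c).

(* the factor contributed to p[f] by one variable x, for the monomial x^a y^b
   and the derivative order l = k_j, up to (-1)^l / ((4 pi)^l l!) *)
Definition phi (l : nat) c (a b : nat) x : R :=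
  derive1n l E (zarg c x) * Dmono l c a b x.

(** M only bounds a + b, so the induction may lower either exponent. Each derivative costs 1 /
    sqrt(- Q1 c) and at most 2 a + 2 b <= 2 M. The 2 fits the coordinate 1 + t with t <= 1. *)
Lemma Dmono_bound (k : nat) c (a b M : nat) x : `|c.1| <= 2 -> `|c.2| <= 2 ->
  (a + b <= M)%N ->
  `|Dmono k c a b x|
    <= ((Num.sqrt (- Q1 c))^-1 * (2 * M%:R)) ^+ k * (1 + (`|x.1| + `|x.2|)) ^+ M.
Proof.
move=> c1 c2; set w := _ + `|x.2|.
have w0 : 0 <= w by rewrite addr_ge0.
elim: k a b => [|k IH] a b abM /=.
  rewrite expr0 mul1r normrM !normrX.
  have [w1 w2] : `|x.1| <= 1 + w /\ `|x.2| <= 1 + w.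
    by have := normr_ge0 x.1; have := normr_ge0 x.2; rewrite /w; split; lra.
  rewrite (@le_trans _ _ ((1 + w) ^+ a * (1 + w) ^+ b))//.
    by apply: ler_pM; rewrite ?exprn_ge0// lerXn2r ?nnegrE ?addr_ge0.
  by rewrite -exprD ler_weXn2l// lerDl.
rewrite normrM ger0_norm ?invr_ge0 ?sqrtr_ge0// exprS -2!mulrA ler_wpM2l ?invr_ge0 ?sqrtr_ge0//.
set K := _ ^+ k * _ in IH *.
have K0 : 0 <= K by apply: le_trans (IH 0 0 _).
rewrite (le_trans (ler_normD _ _))// !normrM !normr_nat.
have Ha : `|Dmono k c a.-1 b x| <= K by apply: IH; rewrite (leq_trans _ abM)// leq_add2r leq_pred.
have Hb : `|Dmono k c a b.-1 x| <= K by apply: IH; rewrite (leq_trans _ abM)// leq_add2l leq_pred.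
rewrite (@le_trans _ _ (2 * (a%:R * K) + 2 * (b%:R * K)))//.
  by apply: lerD; apply: ler_pM => //; rewrite ?mulr_ge0// ler_wpM2l.
by rewrite -mulrDr -mulrDl -natrD mulrA ler_wpM2r// ler_pM2l// ler_nat.
Qed.

Lemma NQ1_c0 t : - Q1 (1, 1 + t) = t * (1 + t / 2).
Proof. by rewrite /Q1 /=; field. Qed.

Lemma sqrt_c0_inv t : 0 < t <= 1 -> 0 < (Num.sqrt (- Q1 (1, 1 + t)))^-1 <= t^-1.
Proof.
move=> /andP[t0 t1]; have w0 : 0 < t * (1 + t / 2) by nra.
rewrite NQ1_c0 invr_gt0 sqrtr_gt0 w0 lef_pV2 ?posrE ?sqrtr_gt0//.
rewrite /= -[leLHS](gtr0_norm t0) -sqrtr_sqr ler_sqrt; [nra|exact: ltW].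
Qed.

(** Since x - (1 + t) y = (1 + t/2) p - (t/2) r, multiplication by - Q1 c = t (1 + t/2) cancels the
    mixed term and leaves (1 + t/2)^2 p^2 + (t/2)^2 r^2. One half of this dominates the p^2 term,
    the other the |p r| term by the inequality of means. *)
Lemma zarg_sqr t x : 0 < t <= 1 ->
  (x.1 - x.2) ^+ 2 / (2 * t) + `|x.1 - x.2| * `|x.1 + x.2| / 2
    <= zarg (1, 1 + t) x ^+ 2 + 2 * Q1 x.
Proof.
move=> /andP[t0 t1]; have w0 : 0 < t * (1 + t / 2) by nra.
rewrite /zarg expr_div_n NQ1_c0 sqr_sqrtr; last exact: ltW.
rewrite /B1 /Q1 /= mul1r.
rewrite -(ler_pM2r w0) mulrDl [leRHS]mulrDl divfK ?gt_eqF//.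
set p := `|x.1 - x.2|; set r := `|x.1 + x.2|.
have pp : (x.1 - x.2) ^+ 2 = p ^+ 2 by rewrite /p real_normK// num_real.
have rr : (x.1 + x.2) ^+ 2 = r ^+ 2 by rewrite /r real_normK// num_real.
have -> : (x.1 - (1 + t) * x.2) ^+ 2
    + 2 * (2^-1 * (x.1 ^+ 2 - x.2 ^+ 2)) * (t * (1 + t / 2))
    = (1 + t / 2) ^+ 2 * p ^+ 2 + t ^+ 2 / 4 * r ^+ 2 by rewrite -pp -rr; field.
have -> : (x.1 - x.2) ^+ 2 / (2 * t) * (t * (1 + t / 2)) = (1 + t / 2) * p ^+ 2 / 2.
  by rewrite pp; field; rewrite gt_eqF.
have : 0 <= ((1 + t / 2) * p - t / 2 * r) ^+ 2 by exact: sqr_ge0.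
have : 0 <= t * p ^+ 2 by rewrite mulr_ge0 ?sqr_ge0 ?ltW.
have : 0 <= t ^+ 2 * r ^+ 2 by rewrite mulr_ge0 ?sqr_ge0.
have : 0 <= t ^+ 2 * p ^+ 2 by rewrite mulr_ge0 ?sqr_ge0.
lra.
Qed.

Definition decay t x : R :=
  expR (- (pi * ((x.1 - x.2) ^+ 2 / (2 * t) + `|x.1 - x.2| * `|x.1 + x.2| / 2))).

(** The modulus of q^{Q_1}, with v absorbed into x. *)
Definition gq x : R := expR (- (2 * pi * Q1 x)).

Lemma gauss_gq t x : 0 < t <= 1 -> gauss (zarg (1, 1 + t) x) * gq x <= decay t x.
Proof.
move=> t01; rewrite /gauss /gq /decay -expRD ler_expR -opprD lerN2.
rewrite [2 * pi]mulrC -[pi * 2 * _]mulrA -mulrDr ler_wpM2l ?pi_ge0//; exact: zarg_sqr.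
Qed.

Lemma E_sg_gq t x : 0 < t <= 1 -> x.1 - x.2 != 0 ->
  `|E (zarg (1, 1 + t) x) - Num.sg (x.1 - x.2)| * gq x <= 2 * decay t x.
Proof.
move=> t01 p0; set p := x.1 - x.2 in p0 *.
set z := zarg _ _.
(* Oddness of E reduces both signs of p to a comparison with 1. *)
have -> : `|E z - Num.sg p| = `|E (Num.sg p * z) - 1|.
  have [p_lt0|p_gt0|p_eq0] := sgrP p.
  - by rewrite p_lt0 eqxx in p0.
  - by rewrite mul1r.
  - by rewrite mulN1r EN -normrN opprB addrC.
have [z0|z0] := leP 0 (Num.sg p * z).
  rewrite (@le_trans _ _ (gauss z * gq x))//.
    rewrite ler_wpM2r ?expR_ge0//; apply: le_trans (E_tail z0) _.
    rewrite /gauss exprMn sqr_sg p0 mul1r lexx//.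
  by rewrite (le_trans (gauss_gq x t01))// ler_peMl ?expR_ge0// ler1n.
apply: ler_pM; rewrite ?expR_ge0//.
  by rewrite (le_trans (ler_normB _ _))// normr1 (_ : 2 = 1 + 1)// lerD2r normr_E_le1.
rewrite ler_expR lerN2 [2 * pi]mulrC -[pi * 2 * _]mulrA ler_wpM2l ?pi_ge0//.
have [t0 t1] := andP t01.
(* The positive denominator of z is cleared and its numerator written as (1 + t/2) p - (t/2) r. *)
have {}z0 : Num.sg p * (p * (1 + t / 2) - t / 2 * (x.1 + x.2)) < 0.
  have [s0 _] := andP (sqrt_c0_inv t01).
  move: z0; rewrite /z /zarg mulrA (pmulr_llt0 _ s0).
  by rewrite /B1 /p /=; apply: le_lt_trans; rewrite le_eqVlt; apply/orP; left; apply/eqP; field.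
rewrite /Q1 [leRHS](_ : _ = p * (x.1 + x.2)); last by rewrite /p; field.
rewrite -/p; set r := x.1 + x.2 in z0 *.
have -> : p ^+ 2 / (2 * t) = p ^+ 2 / 2 / t by field; rewrite gt_eqF.
have key : `|p| * (1 + t / 2) < t / 2 * (Num.sg p * r).
  by rewrite normrEsg -subr_lt0; apply: le_lt_trans z0; rewrite le_eqVlt;
    apply/orP; left; apply/eqP; ring.
have pp : 0 < `|p| by rewrite normr_gt0.
set r' := Num.sg p * r in key.
have r0 : 0 < r' by have := mulr_gt0 t0 pp; nra.
have rE : `|r| = r'.
  by rewrite -[r'](gtr0_norm r0) normrM normr_sg p0 mul1r.
have prE : p * r = `|p| * r'.
  by rewrite /r' normrEsg mulrACA -expr2 sqr_sg p0 mul1r.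
have -> : p ^+ 2 = `|p| ^+ 2 by rewrite real_normK// num_real.
rewrite rE prE -lerBrDr ler_pdivrMr//.
have := mulr_gt0 t0 pp; nra.
Qed.

(** The average of |p| |r| >= d |p| and |p| |r| >= d |r|, combined with |p| + |r| >= |x| + |y|. *)
Lemma cross_ge (d : R) x : 0 < d -> d <= `|x.1 - x.2| -> d <= `|x.1 + x.2| ->
  d * ((`|x.1| + `|x.2|) / 2) <= `|x.1 - x.2| * `|x.1 + x.2|.
Proof.
move=> d0 dp dr; set w := _ + `|x.2|.
have : w <= `|x.1 - x.2| + `|x.1 + x.2|.
  by rewrite /w; case: (ger0P x.1); case: (ger0P x.2);
    case: (ger0P (x.1 - x.2)); case: (ger0P (x.1 + x.2)); lra.
set p := `|_ - _| in dp *; set r := `|x.1 + _| in dr * => wpr.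
rewrite (@le_trans _ _ (d * ((p + r) / 2)))//.
  by rewrite ler_pM2l// ler_pM2r ?invr_gt0.
have : 0 <= (p - d) * r by rewrite mulr_ge0 ?subr_ge0// (le_trans (ltW d0)).
have : 0 <= (r - d) * p by rewrite mulr_ge0 ?subr_ge0// (le_trans (ltW d0)).
lra.
Qed.

(* The Gaussian factor in (x - y)^2 / t beats the powers of 1/t, the factor in
   |x - y| |x + y| beats the powers of 1 + |x| + |y|. *)
Lemma decay_absorbs (N M : nat) (d : R) : 0 < d ->
  exists2 C : R, 0 <= C & exists2 k : R, 0 < k & forall t x, 0 < t <= 1 ->
    d <= `|x.1 - x.2| -> d <= `|x.1 + x.2| ->
    t^-1 ^+ N * (1 + (`|x.1| + `|x.2|)) ^+ M * decay t x
      <= t * (C * expR (- (k * (`|x.1| + `|x.2|)))).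
Proof.
move=> d0; have pi0 := pi_gt0 R.
have c1 : 0 < pi * d ^+ 2 / 2 :> R by rewrite divr_gt0// mulr_gt0// exprn_gt0.
have c2 : 0 < pi * d / 8 :> R by rewrite divr_gt0// mulr_gt0.
(* The extra power of 1/t leaves a spare factor t. *)
have [C1 C10 H1] := expr_le_expR N.+1 c1.
have [C2 C20 H2] := expr_le_expR M c2.
(* [decay] provides e^{- k w} twice: once to absorb the power of 1 + w, once for the conclusion. *)
set k := pi * d / 8 in c2 H2.
exists (C1 * (C2 * expR k)); first by rewrite !mulr_ge0 ?expR_ge0.
exists k => // t x /andP[t0 t1] dp dr.
set w := `|x.1| + `|x.2|.
have w0 : 0 <= w by rewrite addr_ge0.
have dec : decay t x <= expR (- (pi * d ^+ 2 / 2 * t^-1)) * (expR (- (k * w)) * expR (- (k * w))).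
  rewrite -!expRD ler_expR -!opprD lerN2.
  have -> : pi * d ^+ 2 / 2 * t^-1 + (k * w + k * w) = pi * (d ^+ 2 / (2 * t) + d * (w / 2) / 2).
    by rewrite /k; field; rewrite gt_eqF.
  rewrite ler_pM2l//; apply: lerD.
    rewrite ler_pM2r ?invr_gt0 ?mulr_gt0// -[leRHS]real_normK ?num_real//.
    by rewrite lerXn2r ?nnegrE// ltW.
  by rewrite ler_pM2r ?invr_gt0//; exact: cross_ge.
have ti0 : 0 <= t^-1 by rewrite invr_ge0 ltW.
have B1 : t^-1 ^+ N * expR (- (pi * d ^+ 2 / 2 * t^-1)) <= t * C1.
  have := H1 t^-1 ti0; rewrite exprS ler_pdivrMl// => H.
  rewrite expRN ler_pdivrMr ?expR_gt0// -[leRHS]mulrA; exact: H.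
have B2 : (1 + w) ^+ M * expR (- (k * w)) <= C2 * expR k.
  have := H2 (1 + w) (addr_ge0 ler01 w0); rewrite mulrDr mulr1 expRD => H.
  by rewrite expRN ler_pdivrMr ?expR_gt0// -mulrA.
rewrite (le_trans (ler_wpM2l _ dec))//.
  by rewrite mulr_ge0 ?exprn_ge0 ?addr_ge0.
rewrite [leRHS](_ : _ = t * C1 * (C2 * expR k) * expR (- (k * w))); last by rewrite !mulrA.
rewrite [leLHS](_ : _ = (t^-1 ^+ N * expR (- (pi * d ^+ 2 / 2 * t^-1)))
   * ((1 + w) ^+ M * expR (- (k * w))) * expR (- (k * w))); last by ring.
by rewrite ler_wpM2r ?expR_ge0// ler_pM// mulr_ge0 ?exprn_ge0 ?expR_ge0 ?addr_ge0.
Qed.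

Definition phi_lim (l a b : nat) x : R :=
  (l == 0%N)%:R * (Num.sg (x.1 - x.2) * (x.1 ^+ a * x.2 ^+ b)).

Lemma zarg_bound t x : 0 < t <= 1 ->
  1 + `|zarg (1, 1 + t) x| <= 2 * t^-1 * (1 + (`|x.1| + `|x.2|)).
Proof.
move=> t01; have /andP[s0 st] := sqrt_c0_inv t01; have /andP[t0 t1] := t01.
have ti : 1 <= t^-1 by rewrite invf_ge1.
have x1 := normr_ge0 x.1; have x2 := normr_ge0 x.2.
rewrite /zarg normrM (gtr0_norm s0) /B1 /= mul1r.
rewrite (@le_trans _ _ (1 * t^-1 + (2 * (`|x.1| + `|x.2|)) * t^-1))//.
  apply: lerD; [by rewrite mul1r|apply: ler_pM => //; rewrite ?(ltW s0)//].
  rewrite (le_trans (ler_normB _ _))// normrM mulrDr lerD//; first by lra.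
  by rewrite ler_wpM2r// ger0_norm; lra.
rewrite -mulrDl [leRHS]mulrAC ler_pM2r; first by lra.
by rewrite invr_gt0.
Qed.

Lemma phi_c0_approx (l a b : nat) (d : R) : 0 < d ->
  exists2 C : R, 0 <= C & exists2 k : R, 0 < k & forall t x, 0 < t <= 1 ->
    d <= `|x.1 - x.2| -> d <= `|x.1 + x.2| ->
    `|phi l (1, 1 + t) a b x - phi_lim l a b x| * gq x
      <= t * (C * expR (- (k * (`|x.1| + `|x.2|)))).
Proof.
move=> d0; case: l => [|l].
  have [C C0 [k k0 H]] := decay_absorbs 0 (a + b) d0.
  exists (2 * C); first by rewrite mulr_ge0.
  exists k => // t x t01 dp dr.
  rewrite /phi /phi_lim /= mul1r -mulrBl normrM.
  have m := @Dmono_bound 0 (1, 1 + t) a b (a + b) x _ _ (leqnn _).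
  have p0 : x.1 - x.2 != 0 by rewrite -normr_gt0 (lt_le_trans d0).
  have Eb := E_sg_gq t01 p0.
  rewrite mulrAC; apply: (@le_trans _ _ (2 * decay t x * (1 + (`|x.1| + `|x.2|)) ^+ (a + b))).
    apply: ler_pM => //; first by rewrite mulr_ge0 ?expR_ge0.
    move: m; rewrite /= expr0 mul1r; apply; first by rewrite normr1 ler1n.
    by have /andP[t0 t1] := t01; rewrite ger0_norm; lra.
  have := H t x t01 dp dr; rewrite expr0 mul1r => {}H.
  by lra.
have [P HP] := @derive1n_E R l.
have [C1 C10 H1] := horner_bound P.
set M := (a + b)%N; set N := size P.
(* 1/t enters N times through P at z and l + 1 times through the derivatives; 1 + w enters N times
   through P and M times through the monomial. *)
have [C C0 [k k0 H]] := decay_absorbs (N + l.+1) (N + M) d0.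
exists (C1 * 2 ^+ N * (2 * M%:R) ^+ l.+1 * C); first by rewrite !mulr_ge0// exprn_ge0// mulr_ge0.
exists k => // t x t01 dp dr; have /andP[t0 t1] := t01.
have /andP[s0 st] := sqrt_c0_inv t01.
rewrite /phi_lim /= mul0r subr0 /phi HP 2!normrM (ger0_norm (gauss_ge0 _)).
set z := zarg _ _; set w := `|x.1| + `|x.2|.
have w0 : 0 <= w by rewrite addr_ge0.
have ti0 : 0 < t^-1 by rewrite invr_gt0.
have m : `|Dmono l.+1 (1, 1 + t) a b x| <= (t^-1 * (2 * M%:R)) ^+ l.+1 * (1 + w) ^+ M.
  have := @Dmono_bound l.+1 (1, 1 + t) a b M x _ _ (leqnn _).
  rewrite /= normr1 ler1n => /(_ isT) m; apply: le_trans (m _) _.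
    by rewrite ger0_norm; lra.
  rewrite ler_wpM2r ?exprn_ge0 ?addr_ge0// lerXn2r ?nnegrE ?mulr_ge0 ?(ltW s0) ?(ltW ti0)//.
  by rewrite ler_wpM2r// mulr_ge0.
have hz : `|P.[z]| <= C1 * (2 * t^-1 * (1 + w)) ^+ N.
  rewrite (le_trans (H1 z))// ler_wpM2l// lerXn2r ?nnegrE ?addr_ge0//.
  by rewrite !mulr_ge0 ?addr_ge0// ltW.
  exact: zarg_bound.
have gz : gauss z * gq x <= decay t x by exact: gauss_gq.
have dec0 : 0 <= decay t x by exact: expR_ge0.
have g0 : 0 <= gauss z * gq x by rewrite mulr_ge0 ?expR_ge0.
rewrite mulrAC -[_ * _ * gq x]mulrA.
apply: (@le_trans _ _ (C1 * (2 * t^-1 * (1 + w)) ^+ N * decay t x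
    * ((t^-1 * (2 * M%:R)) ^+ l.+1 * (1 + w) ^+ M))).
  apply: ler_pM m; [by rewrite mulr_ge0|exact: normr_ge0|exact: ler_pM gz].
have := ler_wpM2l _ (H t x t01 dp dr) => /(_ (C1 * 2 ^+ N * (2 * M%:R) ^+ l.+1)) {}H.
rewrite [leRHS](_ : _ = (C1 * 2 ^+ N * (2 * M%:R) ^+ l.+1)
  * (t * (C * expR (- (k * w))))); last by ring.
apply: le_trans (H _); last by rewrite !mulr_ge0// exprn_ge0// mulr_ge0.
by rewrite -/w !exprMn !exprD le_eqVlt; apply/orP; left; apply/eqP; ring.
Qed.
End OneVariable.

(** * The difference of the two cone vectors, in one variable *)

Section Difference.
Context {R : realType}.
Implicit Types (x c : R * R) (t : R).

Definition dphi (l : nat) t (a b : nat) x : R :=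
  phi l (1, 1 + t) a b x - phi l (-1, 1 + t) a b x.

Definition dphi_lim (l a b : nat) x : R :=
  (l == 0%N)%:R
    * ((Num.sg (x.1 - x.2) - Num.sg (- x.1 - x.2)) * (x.1 ^+ a * x.2 ^+ b)).

Lemma Dmono_flip (k a b : nat) (u : R) x :
  Dmono k (-1, u) a b x = (-1) ^+ a * Dmono k (1, u) a b (- x.1, x.2).
Proof.
elim: k a b => [|k IH] a b /=.
  by rewrite mulrA -exprMn mulN1r opprK.
have -> : Q1 (-1, u) = Q1 (1, u) by rewrite /Q1 /= sqrrN.
(* For a = 0 the induction hypothesis at [a.-1] gives the wrong sign, but that term has the factor
   0. *)
rewrite !IH; case: a => [|a] /=; first by ring.
by rewrite exprS; ring.
Qed.

Lemma phi_flip (l a b : nat) t x :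
  phi l (-1, 1 + t) a b x = (-1) ^+ a * phi l (1, 1 + t) a b (- x.1, x.2).
Proof.
rewrite /phi Dmono_flip /zarg.
have -> : Q1 (-1, 1 + t) = Q1 (1, 1 + t) by rewrite /Q1 /= sqrrN.
have -> : B1 (-1, 1 + t) x = B1 (1, 1 + t) (- x.1, x.2) by rewrite /B1 /= mulN1r mul1r.
by rewrite mulrCA.
Qed.

Lemma dphi_approx (l a b : nat) (d : R) : 0 < d ->
  exists2 C : R, 0 <= C & exists2 k : R, 0 < k & forall t x, 0 < t <= 1 ->
    d <= `|x.1 - x.2| -> d <= `|x.1 + x.2| ->
    `|dphi l t a b x - dphi_lim l a b x| * gq x
      <= t * (C * expR (- (k * (`|x.1| + `|x.2|)))).
Proof.
move=> d0; have [C C0 [k k0 H]] := phi_c0_approx l a b d0.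
exists (2 * C); first by rewrite mulr_ge0.
exists k => // t x t01 dp dr.
have H1 := H t x t01 dp dr.
have H2 : `|(-1) ^+ a * (phi l (1, 1 + t) a b (- x.1, x.2) - phi_lim l a b (- x.1, x.2))| * gq x
      <= t * (C * expR (- (k * (`|x.1| + `|x.2|)))).
  (* The reflection sends p to - r and r to - p, so the two lower bounds change places. *)
  have /= := H t (- x.1, x.2) t01.
  rewrite -opprD normrN normrN (addrC (- x.1)) distrC => /(_ dr dp).
  by rewrite normrM normrX normrN1 expr1n mul1r /gq /Q1 /= sqrrN.
have -> : dphi l t a b x - dphi_lim l a b x = (phi l (1, 1 + t) a b x - phi_lim l a b x)
   - (-1) ^+ a * (phi l (1, 1 + t) a b (- x.1, x.2) - phi_lim l a b (- x.1, x.2)).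
  rewrite /dphi phi_flip /dphi_lim /phi_lim /=.
  rewrite [(- x.1) ^+ a]exprNn; have := signrMK a (1 : R); rewrite mulr1.
  by set e := (-1) ^+ a => ee; ring: ee.
apply: le_trans (ler_wpM2r (expR_ge0 _) (ler_normB _ _)) _.
rewrite mulrDl (le_trans (lerD H1 H2))//; lra.
Qed.

Lemma dphi_lim_bound (l a b : nat) (d : R) : 0 < d ->
  exists2 C : R, 0 <= C & exists2 k : R, 0 < k & forall x,
    d <= `|x.1 - x.2| -> d <= `|x.1 + x.2| ->
    `|dphi_lim l a b x| * gq x <= C * expR (- (k * (`|x.1| + `|x.2|))).
Proof.
move=> d0; have pi0 := pi_gt0 R.
have k0 : 0 < pi * d / 4 :> R by rewrite divr_gt0// mulr_gt0.
have [C C0 H] := expr_le_expR (a + b) k0.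
(* [cross_ge] gives pi |p r| >= 2 k w; half of this absorbs the monomial. *)
set k := pi * d / 4 in k0 H.
exists (2 * (C * expR k)); first by rewrite !mulr_ge0 ?expR_ge0.
exists k => // x dp dr.
set w := _ + `|x.2|; have w0 : 0 <= w by rewrite addr_ge0.
have [pr|pr] := leP ((x.1 - x.2) * (x.1 + x.2)) 0.
  suff -> : dphi_lim l a b x = 0.
    by rewrite normr0 mul0r !mulr_ge0 ?expR_ge0.
  rewrite /dphi_lim (_ : Num.sg (x.1 - x.2) = Num.sg (- x.1 - x.2)) ?subrr ?mul0r ?mulr0//.
  rewrite -opprD sgrN.
  have p0 : x.1 - x.2 != 0 by rewrite -normr_gt0 (lt_le_trans d0).
  have r0 : x.1 + x.2 != 0 by rewrite -normr_gt0 (lt_le_trans d0).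
  have [p1|p1|p1] := ltgtP 0 (x.1 - x.2); last by rewrite -p1 eqxx in p0.
    rewrite (gtr0_sg p1) ltr0_sg ?opprK//.
    by rewrite lt_neqAle r0 -(pmulr_rle0 _ p1).
  rewrite (ltr0_sg p1) gtr0_sg//.
  by rewrite lt_neqAle eq_sym r0 -(nmulr_rle0 _ p1).
have gE : gq x <= expR (- (k * w)) * expR (- (k * w)).
  rewrite /gq -expRD ler_expR -opprD lerN2.
  have -> : 2 * pi * Q1 x = pi * (`|x.1 - x.2| * `|x.1 + x.2|).
    by rewrite -normrM gtr0_norm// /Q1; field.
  have -> : k * w + k * w = pi * (d * (w / 2)) by rewrite /k; field.
  by rewrite ler_pM2l//; exact: cross_ge.
have mono : `|dphi_lim l a b x| <= 2 * (1 + w) ^+ (a + b).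
  have := @Dmono_bound R 0 (1, 1) a b (a + b) x _ _ (leqnn _).
  rewrite /= normr1 ler1n expr0 mul1r => /(_ isT isT) m.
  rewrite /dphi_lim normrM normr_nat normrM.
  apply: (@le_trans _ _ (1 * (2 * `|x.1 ^+ a * x.2 ^+ b|))); last by rewrite mul1r ler_pM2l.
  apply: ler_pM => //; rewrite ?mulr_ge0//; first by case: (l == _)%N; rewrite ?ler01 ?lexx.
  rewrite ler_wpM2r// (le_trans (ler_normB _ _))// !normr_sg.
  by rewrite (_ : 2 = 1 + 1)// lerD//; case: (_ != 0); rewrite ?ler01 ?lexx.
have B2 : (1 + w) ^+ (a + b) * expR (- (k * w)) <= C * expR k.
  have := H (1 + w) (addr_ge0 ler01 w0); rewrite mulrDr mulr1 expRD => {}H.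
  by rewrite expRN ler_pdivrMr ?expR_gt0// -mulrA.
apply: le_trans (ler_pM _ _ mono gE) _; rewrite ?expR_ge0//.
by rewrite [leLHS]mulrA ler_wpM2r ?expR_ge0// -[leLHS]mulrA ler_pM2l.
Qed.

(** * Estimates on the shifted lattice *)

Definition G1 (k : R) (n : int * int) : R :=
  expR (- (k * (`|n.1%:~R| + `|n.2%:~R|))).

Lemma G1_ge0 k n : 0 <= G1 k n.
Proof. exact: expR_ge0. Qed.

Lemma le_G1 (k k' : R) n : k <= k' -> G1 k' n <= G1 k n.
Proof. by move=> kk'; rewrite ler_expR lerN2 ler_wpM2r// addr_ge0. Qed.

(** One pair (C, k) controls the size of the limit as well as the error, since a product needs
    both. *)
Definition approx1 (F : R -> int * int -> R) (F0 : int * int -> R) : Prop :=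
  exists2 C : R, 0 <= C & exists2 k : R, 0 < k & forall n,
    `|F0 n| <= C * G1 k n
    /\ forall t, 0 < t <= 1 -> `|F t n - F0 n| <= t * (C * G1 k n).

(** The integers next to z are its floor and the successor of the floor, both at positive
    distance. *)
Lemma nonint_dist (z : R) : z \isn't a Num.int ->
  exists2 d : R, 0 < d & forall n : int, d <= `|z + n%:~R|.
Proof.
move=> zZ; have z1 : (Num.floor z)%:~R < z.
  rewrite lt_neqAle floor_le_tmp andbT; apply: contra zZ => /eqP <-.
  exact: intr_int.
have z2 : z < (Num.floor z)%:~R + 1 by rewrite -intrD1 floorD1_gt.
exists (Num.min (z - (Num.floor z)%:~R) ((Num.floor z)%:~R + 1 - z)).
  by rewrite lt_min !subr_gt0 z1.
move=> n; have [nz|nz] := leP (- n) (Num.floor z).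
  rewrite ge_min (le_trans _ (ler_norm _))//.
  by rewrite lerD2l lerNl -mulrNz ler_int.
rewrite ge_min orbC -normrN opprD (le_trans _ (ler_norm _))// addrC lerD2l.
by rewrite -mulrNz -intrD1 ler_int lezD1.
Qed.

Lemma dphi_lattice_approx (l a b : nat) (s : R) (y : R * R) : 0 < s ->
  B1 (1, 1) y \isn't a Num.int -> B1 (-1, 1) y \isn't a Num.int ->
  let x (n : int * int) := (s * (y.1 + n.1%:~R), s * (y.2 + n.2%:~R)) in
  approx1 (fun t n => dphi l t a b (x n) * gq (x n))
          (fun n => dphi_lim l a b (x n) * gq (x n)).
Proof.
move=> s0 Y1 Y2 x; rewrite /B1 /= !mul1r in Y1 Y2.
have [d1 d10 H1] := nonint_dist Y1.
have [d2 d20 H2] := nonint_dist Y2.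
pose d := s * Num.min d1 d2.
have d0 : 0 < d by rewrite mulr_gt0// lt_min d10.
have dp n : d <= `|(x n).1 - (x n).2|.
  have -> : (x n).1 - (x n).2 = s * (y.1 - y.2 + (n.1 - n.2)%:~R) by rewrite /= intrB; ring.
  rewrite normrM gtr0_norm// ler_pM2l// ge_min; apply/orP; left; exact: H1.
have dr n : d <= `|(x n).1 + (x n).2|.
  have -> : (x n).1 + (x n).2 = - (s * (-1 * y.1 - y.2 + (- n.1 - n.2)%:~R)).
    by rewrite /= intrB mulrNz; ring.
  rewrite normrN normrM gtr0_norm// ler_pM2l// ge_min; apply/orP; right; exact: H2.
have [C C0 [k k0 HC]] := dphi_approx l a b d0.
have [C' C'0 [k' k'0 HC']] := dphi_lim_bound l a b d0.
(* By the reverse triangle inequality the shift y costs only a constant factor, and the majorant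
   depends on n alone. *)
have xn k'' n : 0 < k'' -> expR (- (k'' * (`|(x n).1| + `|(x n).2|)))
    <= expR (k'' * s * (`|y.1| + `|y.2|)) * G1 (k'' * s) n.
  move=> k''0; rewrite /G1 -expRD ler_expR.
  have e1 : s * (`|n.1%:~R| - `|y.1|) <= `|(x n).1|.
    rewrite /= normrM gtr0_norm// ler_pM2l// [y.1 + _]addrC; exact: lerB_normD.
  have e2 : s * (`|n.2%:~R| - `|y.2|) <= `|(x n).2|.
    rewrite /= normrM gtr0_norm// ler_pM2l// [y.2 + _]addrC; exact: lerB_normD.
  have := ler_wpM2l (ltW k''0) (lerD e1 e2); lra.
pose K := expR (k * s * (`|y.1| + `|y.2|)); pose K' := expR (k' * s * (`|y.1| + `|y.2|)).
have K0 : 0 <= K by exact: expR_ge0.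
have K'0 : 0 <= K' by exact: expR_ge0.
exists (C * K + C' * K'); first by rewrite addr_ge0// mulr_ge0.
exists (Num.min (k * s) (k' * s)); first by rewrite lt_min !mulr_gt0.
move=> n; have g1 : G1 (k * s) n <= G1 (Num.min (k * s) (k' * s)) n.
  by apply: le_G1; rewrite ge_min lexx.
have g2 : G1 (k' * s) n <= G1 (Num.min (k * s) (k' * s)) n.
  by apply: le_G1; rewrite ge_min lexx orbT.
have gq0 : 0 <= gq (x n) by exact: expR_ge0.
split=> [|t t01].
  rewrite normrM (ger0_norm gq0) (le_trans (HC' _ (dp n) (dr n)))//.
  rewrite [leRHS]mulrDl; apply: ler_wpDl; first exact: mulr_ge0 (mulr_ge0 C0 K0) (G1_ge0 _ _).
  rewrite -mulrA; apply: ler_wpM2l => //.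
  by rewrite (le_trans (xn _ _ _))// ler_wpM2l.
have [t0 _] := andP t01.
rewrite -mulrBl normrM (ger0_norm gq0) (le_trans (HC _ _ t01 (dp n) (dr n)))//.
rewrite (ler_pM2l t0) [leRHS]mulrDl; apply: ler_wpDr;
  first exact: mulr_ge0 (mulr_ge0 C'0 K'0) (G1_ge0 _ _).
rewrite -mulrA; apply: ler_wpM2l => //.
by rewrite (le_trans (xn _ _ _))// ler_wpM2l.
Qed.

(** * Products over the variables and a summable majorant *)

Section Product.
Context {m : nat}.
Local Notation idx := {ffun 'I_m -> int * int}.

Definition Gm (k : R) (n : idx) : R := \prod_j G1 k (n j).

Lemma le_Gm k k' n : k <= k' -> Gm k' n <= Gm k n.
Proof. by move=> kk'; apply: ler_prod => j _; rewrite G1_ge0 le_G1. Qed.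

Lemma Gm_ge0 k n : 0 <= Gm k n.
Proof. by apply: prodr_ge0 => j _; exact: G1_ge0. Qed.

Lemma approx1_prod (F : 'I_m -> R -> int * int -> R) (F0 : 'I_m -> int * int -> R) :
  (forall j, approx1 (F j) (F0 j)) ->
  exists2 C : R, 0 <= C & exists2 k : R, 0 < k & forall n : idx,
    `|\prod_j F0 j (n j)| <= C * Gm k n
    /\ forall t, 0 < t <= 1 ->
       `|\prod_j F j t (n j) - \prod_j F0 j (n j)| <= t * (C * Gm k n).
Proof.
move=> FF0; rewrite /Gm; elim: (index_enum _) => [|i r [C C0 [k k0 IH]]].
  exists 1 => //; exists 1 => // n; rewrite !big_nil normr1 mulr1; split=> // t /andP[/ltW t0 _].
  by rewrite !big_nil subrr normr0 mulr1.
have [D D0 [l l0 H]] := FF0 i.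
(* 3 counts the terms of a b - a0 b0 = (a - a0)(b - b0) + (a - a0) b0 + a0 (b - b0); the first is
   O(t^2), and t^2 <= t. *)
exists (3 * (D * C)); first by rewrite !mulr_ge0.
exists (Num.min k l) => [|n]; first by rewrite lt_min k0.
have [IH1 IH2] := IH n; have [H1 H2] := H (n i).
rewrite !big_cons; set P0 := \prod_(j <- r) F0 j (n j) in IH1 IH2 *.
set P := \prod_(j <- r) G1 _ _ in IH1 IH2.
set Q := \prod_(j <- r) G1 _ _.
have P_0 : 0 <= P by apply: prodr_ge0 => j _; exact: G1_ge0.
have PQ : P <= Q by apply: ler_prod => j _; rewrite G1_ge0 le_G1// ge_min lexx.
set g := G1 l _ in H1 H2; set h := G1 _ (n i).
have g0 : 0 <= g by exact: G1_ge0.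
have gh : g <= h by apply: le_G1; rewrite ge_min lexx orbT.
have main : D * g * (C * P) <= D * C * (h * Q).
  by rewrite mulrACA ler_wpM2l ?mulr_ge0// ler_pM.
have DC0 : 0 <= D * g * (C * P) by rewrite !mulr_ge0.
have step1 : `|F0 i (n i) * P0| <= D * g * (C * P) by rewrite normrM ler_pM.
split=> [|t t01].
  apply: (le_trans (le_trans step1 main)); rewrite -[leRHS]mulrA ler_peMl//.
    exact: le_trans main.
  by rewrite ler1n.
have [t0 t1] := andP t01.
have {}H2 := H2 t t01; have := IH2 t t01; rewrite !big_cons.
set Pt := \prod_(j <- r) F j t (n j); rewrite -/P0 => {}IH2.
have -> : F i t (n i) * Pt - F0 i (n i) * P0
   = (F i t (n i) - F0 i (n i)) * (Pt - P0) + (F i t (n i) - F0 i (n i)) * P0 + F0 i (n i) * (Pt - P0) by ring.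
have b1 : `|(F i t (n i) - F0 i (n i)) * (Pt - P0)| <= t * (D * g) * (t * (C * P)).
  by rewrite normrM ler_pM.
have b2 : `|(F i t (n i) - F0 i (n i)) * P0| <= t * (D * g) * (C * P).
  by rewrite normrM ler_pM.
have b3 : `|F0 i (n i) * (Pt - P0)| <= (D * g) * (t * (C * P)).
  by rewrite normrM ler_pM.
have b1' : t * (D * g) * (t * (C * P)) <= t * (D * g * (C * P)).
  by rewrite mulrACA -mulrA ler_pM2l// ler_piMl.
have b4 : t * (3 * (D * g * (C * P))) <= t * (3 * (D * C) * (h * Q)).
  by rewrite ler_pM2l// -[leRHS]mulrA ler_pM2l.
apply: le_trans b4; apply: le_trans (ler_normD _ _) _.
apply: le_trans (lerD (ler_normD _ _) (lexx _)) _; lra.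
Qed.

Lemma sum_expR_le (k : R) (N : nat) : 0 < k ->
  \sum_(i < N) expR (- (k * i%:R)) <= (1 - expR (- k))^-1.
Proof.
move=> k0; have q0 : 0 < 1 - expR (- k) by rewrite subr_gt0 -expR0 ltr_expR oppr_lt0.
rewrite -div1r ler_pdivlMr//.
rewrite (eq_bigr (fun i : 'I_N => expR (- k) ^+ i)); last first.
  by move=> i _; rewrite -expRM_natl mulrN mulrC.
rewrite -opprB mulrN mulrC -subrX1 opprB lerBlDr lerDl exprn_ge0// expR_ge0.
Qed.

(** A finite set lies in a box, over which the sum factors into 2 m one-dimensional sums, each at
    most twice a geometric series whatever the size of the box. *)
Lemma Gm_bounded (k : R) : 0 < k ->
  exists M : R, forall A, summability.partial_sum (Gm k) A <= M.
Proof.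
move=> k0; pose S := 2 * (1 - expR (- k))^-1.
exists ((S * S) ^+ m) => A.
pose N := (\max_(n <- A) \max_j maxn `|(n j).1| `|(n j).2|).+1.
(* Integers are coded by absolute value and sign. As 0 has two codes, the sum over codes only bounds
   the sum over A from above. *)
pose sg (u : 'I_N * bool) : int := if u.2 then Posz u.1 else - Posz u.1.
pose J : finType := {ffun 'I_m -> ('I_N * bool) * ('I_N * bool)}.
pose h (f : J) : idx := [ffun j => (sg (f j).1, sg (f j).2)].
have sgP (z : int) : (`|z| < N)%N -> exists u, sg u = z.
  move=> zN; exists (Ordinal zN, 0 <= z); rewrite /sg /=.
  by have [z0|z0] := leP 0 z; [rewrite gez0_abs|rewrite ltz0_abs// opprK].
have hP n : n \in A -> exists f, h f = n.
  move=> nA.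
  have nN j : (maxn `|(n j).1| `|(n j).2| < N)%N.
    by rewrite ltnS (leq_trans _ (leq_bigmax_seq _ nA _))// (leq_trans _ (leq_bigmax j))//.
  have [f1 Hf1] : exists f : {ffun 'I_m -> 'I_N * bool}, forall j, sg (f j) = (n j).1.
    have /(_ _)/cid H j : exists u, sg u = (n j).1.
      by apply: sgP; apply: leq_ltn_trans (nN j); exact: leq_maxl.
    by exists [ffun j => sval (H j)] => j; rewrite ffunE (svalP (H j)).
  have [f2 Hf2] : exists f : {ffun 'I_m -> 'I_N * bool}, forall j, sg (f j) = (n j).2.
    have /(_ _)/cid H j : exists u, sg u = (n j).2.
      by apply: sgP; apply: leq_ltn_trans (nN j); exact: leq_maxr.
    by exists [ffun j => sval (H j)] => j; rewrite ffunE (svalP (H j)).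
  exists [ffun j => (f1 j, f2 j)]; apply/ffunP => j.
  by rewrite !ffunE Hf1 Hf2; case: (n j).
rewrite psumE (@le_trans _ _ (\sum_(f : J) Gm k (h f)))//.
  (* A choice of codes, injective on A because [h] undoes it. *)
  have [g gP] : exists g : idx -> J, forall n, n \in A -> h (g n) = n.
    exists (fun n => odflt [ffun=> ((ord0, true), (ord0, true))] [pick f | h f == n]).
    move=> n /hP[f hf]; case: pickP => [f' /eqP//|/(_ f)].
    by rewrite hf eqxx.
  have gA : uniq (map g A).
    rewrite map_inj_in_uniq ?fset_uniq// => n n' nA n'A gg.
    by rewrite -(gP n)// gg gP.
  rewrite (@eq_big_seq _ _ _ _ _ _ (Gm k \o h \o g)) => [|n nA]; last by rewrite /= gP.
  rewrite -(big_map g xpredT (fun f => Gm k (h f))) big_uniq//= [leRHS](bigID (mem (map g A)))/=.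
  by rewrite lerDl sumr_ge0// => f _; exact: Gm_ge0.
pose e (v : 'I_N * bool) : R := expR (- (k * `|(sg v)%:~R|)).
have -> : \sum_(f : J) Gm k (h f) = ((\sum_v e v) * (\sum_v e v)) ^+ m.
  have -> : (\sum_v e v) * (\sum_v e v) = \sum_(p : ('I_N * bool) * ('I_N * bool)) e p.1 * e p.2.
    rewrite mulr_suml -(pair_bigA _ (fun u v => e u * e v)) /=.
    by apply: eq_bigr => u _; rewrite mulr_sumr.
  rewrite -[X in _ ^+ X](card_ord m) -prodr_const bigA_distr_bigA /=.
  apply: eq_bigr => f _; apply: eq_bigr => j _.
  by rewrite /h /G1 /e ffunE /= mulrDr opprD expRD.
have eS : \sum_v e v <= S.
  rewrite /S mulrC -(pair_bigA _ (fun i b => e (i, b))) /=.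
  rewrite (eq_bigr (fun i : 'I_N => expR (- (k * i%:R)) * 2)) => [|i _].
    by rewrite -mulr_suml ler_wpM2r// sum_expR_le.
  rewrite big_bool /= /e /sg /= mulrNz normrN normr_nat mulr_natr mulr2n//.
have e0 : 0 <= \sum_v e v by apply: sumr_ge0 => v _; exact: expR_ge0.
have S0 := le_trans e0 eS.
by rewrite lerXn2r ?nnegrE ?(mulr_ge0 e0 e0) ?(mulr_ge0 S0 S0)// (ler_pM e0 e0 eS eS).
Qed.
End Product.
End Difference.

(** * Expansion of p[f] into monomials *)

Section Derivations.
Context {K : comNzRingType} {m : nat}.
Local Notation mp := {mpoly K[(m + m)%N]}.
Implicit Types (f g h : mp) (s u w : 'I_m -> K) (i j : 'I_m).
Local Notation Xl j a := ('X_(lshift m j) ^+ a : mp).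
Local Notation Yr j b := ('X_(rshift m j) ^+ b : mp).

(** [s], [u], [w] stand for 1 / sqrt(- Q1 c), c_1 and c_2; as abstract scalars they allow any
    commutative ring. *)
Definition dirD s u w (j : 'I_m) f : mp :=
  s j *: (u j *: f^`M(lshift m j) + w j *: f^`M(rshift m j)).

(** The polynomial whose values are given by [Dmono]. *)
Fixpoint dirDmono s u w (k : nat) (j : 'I_m) (a b : nat) : mp :=
  if k is k'.+1 then
    s j *: (u j *: (dirDmono s u w k' j a.-1 b *+ a)
          + w j *: (dirDmono s u w k' j a b.-1 *+ b))
  else Xl j a * Yr j b.

Lemma mderivXn (i j : 'I_(m + m)) (a : nat) :
  mderiv i ('X_j ^+ a : mp) = (i == j)%:R *: ('X_j ^+ a.-1 *+ a).
Proof.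
rewrite !mpolyXn mderivX mulmnE mnmE eq_sym.
have [->|ij] := eqVneq i j; last by rewrite mul0n !scale0r.
rewrite mul1n scale1r; case: a => [|a]; first by rewrite scale0r.
rewrite scaler_nat; congr (_ *+ _); congr 'X_[_].
by apply/mnmP => k; rewrite mnmBE !mulmnE !mnmE mulnS addKn.
Qed.

Lemma dirD_linear s u w j : linear (dirD s u w j).
Proof.
move=> z f g; rewrite /dirD !mderivD !mderivZ !scalerDr !scalerA.
by rewrite addrACA; congr (_ *: _ + _ *: _ + _); ring.
Qed.

Lemma linear_iter (k : nat) (D : mp -> mp) : linear D -> linear (iter k D).
Proof. by move=> lD z f g; elim: k => //= k ->; exact: lD. Qed.

Lemma linear_comp_big (D : 'I_m -> mp -> mp) (r : seq 'I_m) :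
  (forall j, linear (D j)) -> linear (\big[(fun F G => F \o G)/id]_(j <- r) D j).
Proof.
move=> lD z; elim: r => [|j r IH] f g; first by rewrite !big_nil.
by rewrite !big_cons /= IH lD.
Qed.

Lemma linear_scale (D : mp -> mp) : linear D -> forall z f, D (z *: f) = z *: D f.
Proof.
move=> lD z f; have := lD z f 0; rewrite addr0 => ->.
by have := lD (-1) 0 0; rewrite scaler0 addr0 scaleN1r addNr => ->; rewrite addr0.
Qed.

Lemma dirD_mono s u w j a b h : h^`M(lshift m j) = 0 -> h^`M(rshift m j) = 0 ->
  dirD s u w j (Xl j a * Yr j b * h)
  = s j *: (u j *: (Xl j a.-1 * Yr j b * h *+ a) + w j *: (Xl j a * Yr j b.-1 * h *+ b)).
Proof.
rewrite /dirD => hx hy; rewrite !mderivM hx hy !mulr0 !addr0 !mderivXn.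
rewrite !eqxx eq_lrshift eq_rlshift !scale0r !scale1r mulr0 mul0r addr0 add0r.
by rewrite !mulrnAl !mulrnAr !mulrnAl.
Qed.

Lemma iter_dirD_mono s u w j k a b h : h^`M(lshift m j) = 0 -> h^`M(rshift m j) = 0 ->
  iter k (dirD s u w j) (Xl j a * Yr j b * h) = dirDmono s u w k j a b * h.
Proof.
move=> hx hy; elim: k a b => [//|k IH] a b.
have il := linear_iter k (dirD_linear s u w j).
rewrite iterSr dirD_mono// (linear_scale il) -!scaler_nat scalerA il scalerA (linear_scale il) !IH /=.
by rewrite -!scaler_nat !scalerA -scalerAl mulrDl -!scalerAl.
Qed.

Lemma mderiv_dirDmono (i : 'I_(m + m)) s u w j k a b :
  i != lshift m j -> i != rshift m j -> mderiv i (dirDmono s u w k j a b) = 0.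
Proof.
move=> il ir; elim: k a b => [|k IH] a b /=.
  by rewrite mderivM !mderivXn (negPf il) (negPf ir) !scale0r mul0r mulr0 addr0.
by rewrite mderivZ mderivD !mderivZ !mderivMn !IH !mul0rn !scaler0 addr0 scaler0.
Qed.

Lemma mderiv_dirDmono_neq s u w i j k a b : i != j ->
  mderiv (lshift m i) (dirDmono s u w k j a b) = 0
  /\ mderiv (rshift m i) (dirDmono s u w k j a b) = 0.
Proof.
by move=> ij; rewrite !mderiv_dirDmono ?eq_lshift ?eq_rshift ?eq_lrshift ?eq_rlshift.
Qed.

Lemma comp_dirD_mono s u w (k a b : 'I_m -> nat) :
  (\big[(fun F G => F \o G)/id]_(j < m) iter (k j) (dirD s u w j))
    (\prod_j (Xl j (a j) * Yr j (b j)))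
  = \prod_j dirDmono s u w (k j) j (a j) (b j).
Proof.
(* The factor h is free of the variables in r, so their derivations treat it as a constant. It takes
   up the monomial of the head variable while the tail is differentiated. *)
suff H (r : seq 'I_m) h : uniq r ->
    (forall j, j \in r -> h^`M(lshift m j) = 0 /\ h^`M(rshift m j) = 0) ->
    (\big[(fun F G => F \o G)/id]_(j <- r) iter (k j) (dirD s u w j))
      ((\prod_(j <- r) (Xl j (a j) * Yr j (b j))) * h)
    = (\prod_(j <- r) dirDmono s u w (k j) j (a j) (b j)) * h.
  have := H (index_enum _) 1 (index_enum_uniq _); rewrite !mulr1; apply=> j _.
  by rewrite -mpolyC1 !mderivC.
elim: r h => [|i r IH] h; first by rewrite !big_nil.
move=> /andP[ir ur] hr; rewrite !big_cons /=.
have rD j : j \in r -> j != i by move=> jr; apply: contraNneq ir => <-.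
rewrite -(mulrA _ (\prod_(j <- r) (_ * _)) h)
  (mulrCA _ (\prod_(j <- r) (_ * _)) h) IH//; last first.
  move=> j jr; have [hx hy] : h^`M(lshift m j) = 0 /\ h^`M(rshift m j) = 0.
    by apply: hr; rewrite in_cons jr orbT.
  (* Order 0 is the monomial itself. *)
  have [e1 e2] := mderiv_dirDmono_neq s u w 0 (a i) (b i) (rD j jr).
  by split; rewrite mderivM; [rewrite hx [X in X * h]e1|rewrite hy [X in X * h]e2];
    rewrite mul0r mulr0 addr0.
have [hx hy] := hr i (mem_head _ _).
have prod0 (v : 'I_(m + m)) :
    (forall j, j \in r -> mderiv v (dirDmono s u w (k j) j (a j) (b j)) = 0) ->
    mderiv v (\prod_(j <- r) dirDmono s u w (k j) j (a j) (b j)) = 0.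
  move=> D0; rewrite big_seq; apply: (big_ind (fun p => mderiv v p = 0)) => //.
  - by rewrite -mpolyC1 mderivC.
  - by move=> p q p0 q0; rewrite mderivM p0 q0 mul0r mulr0 addr0.
rewrite mulrCA iter_dirD_mono; first by rewrite mulrA.
- rewrite mderivM hx mulr0 addr0 prod0 ?mul0r// => j jr.
  by rewrite (proj1 (mderiv_dirDmono_neq _ _ _ _ _ _ _))// eq_sym rD.
- rewrite mderivM hy mulr0 addr0 prod0 ?mul0r// => j jr.
  by rewrite (proj2 (mderiv_dirDmono_neq _ _ _ _ _ _ _))// eq_sym rD.
Qed.

Lemma mpolyX_split (mm : 'X_{1..(m + m)}) :
  'X_[mm] = \prod_j (Xl j (mm (lshift m j)) * Yr j (mm (rshift m j))).
Proof. by rewrite mpolyXE_id big_split_ord big_split. Qed.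

Lemma comp_dirDE s u w (k : 'I_m -> nat) f :
  (\big[(fun F G => F \o G)/id]_(j < m) iter (k j) (dirD s u w j)) f
  = \sum_(mm <- msupp f) f@_mm *:
      \prod_j dirDmono s u w (k j) j (mm (lshift m j)) (mm (rshift m j)).
Proof.
set F := \big[_/_]_(j < m) _.
have lF : linear F by apply: linear_comp_big => j; apply: linear_iter; exact: dirD_linear.
have D g h : F (g + h) = F g + F h by have := lF 1 g h; rewrite !scale1r.
have N : F 0 = 0 by have := linear_scale lF 0 0; rewrite !scale0r.
rewrite [f in LHS]mpolyE (big_morph _ D N); apply: eq_bigr => mm _ /=.
by rewrite (linear_scale lF) mpolyX_split /F comp_dirD_mono.
Qed.

End Derivations.

(** * Evaluation of the derivatives and of p[f] *)

Section Expansion.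
Context {R : realType} {m : nat}.
Local Notation mp := {mpoly R[i][(m + m)%N]}.
Implicit Types (f g h : mp) (x c : 'I_m -> R * R) (i j : 'I_m).

Lemma coords_lshift (y : 'I_m -> R * R) j : coords y (lshift m j) = (y j).1%:C.
Proof. by rewrite /coords (unsplitK (inl j)). Qed.

Lemma coords_rshift (y : 'I_m -> R * R) j : coords y (rshift m j) = (y j).2%:C.
Proof. by rewrite /coords (unsplitK (inr j)). Qed.

Local Notation expl mm := (fun j : 'I_m => mm (lshift m j)).
Local Notation expr mm := (fun j : 'I_m => mm (rshift m j)).

Lemma eval_dirDmono c x k j a b :
  evalp (dirDmono (fun j => (Num.sqrt (- Q1 (c j)))^-1%:C)
    (fun j => (c j).1%:C) (fun j => (c j).2%:C) k j a b) x
  = (Dmono k (c j) a b (x j))%:C.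
Proof.
rewrite /evalp; elim: k a b => [|k IH] a b /=.
  by rewrite mevalM !rmorphXn /= !mevalXU coords_lshift coords_rshift rmorphM !rmorphXn.
by rewrite mevalZ mevalD !mevalZ !mevalMn !IH rmorphM rmorphD !rmorphM !rmorph_nat !mulr_natl.
Qed.

Lemma eval_Dcs c (k : 'I_m -> nat) f x :
  evalp (Dcs c k f) x
  = \sum_(mm <- msupp f) f@_mm * (\prod_j Dmono (k j) (c j) (expl mm j) (expr mm j) (x j))%:C.
Proof.
have -> : Dcs c k f = (\big[(fun F G => F \o G)/id]_(j < m) iter (k j)
    (dirD (fun j => (Num.sqrt (- Q1 (c j)))^-1%:C)
    (fun j => (c j).1%:C) (fun j => (c j).2%:C) j)) f by [].
rewrite comp_dirDE /evalp raddf_sum; apply: eq_bigr => mm _ /=.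
rewrite mevalZ !rmorph_prod; congr (_ * _); apply: eq_bigr => j _.
exact: eval_dirDmono.
Qed.

Lemma evalpE f x :
  evalp f x = \sum_(mm <- msupp f)
    f@_mm * (\prod_j ((x j).1 ^+ expl mm j * (x j).2 ^+ expr mm j))%:C.
Proof.
rewrite /evalp mevalE; apply: eq_bigr => mm _; congr (_ * _).
rewrite big_split_ord rmorph_prod /=.
under [RHS]eq_bigr do rewrite rmorphM !rmorphXn /=.
by rewrite [RHS]big_split; congr (_ * _); apply: eq_bigr => j _;
  rewrite ?coords_lshift ?coords_rshift.
Qed.

(* The sum over sigma becomes a product over the variables. *)
Lemma pfun_expand t f x :
  pfun (@c0vec R m t) (@c1vec R m t) f x
  = \sum_(mm <- msupp f) \sum_(0 <= k < (degree f).+1)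
      \sum_(kv : {ffun 'I_m -> 'I_k.+1} | (\sum_j kv j == k)%N)
      f@_mm * ((-1) ^+ k / (4 * pi) ^+ k)%:C * 
       (\prod_j (((kv j)`!)%:R^-1 * dphi (kv j) t (expl mm j) (expr mm j) (x j)))%:C.
Proof.
have shuffle (K : comPzRingType) (e z p y q : K) : e * (z * (p * (y * q))) = y * z * (e * (p * q)).
  by ring.
have PQ (N : nat) (p q : R) : ((-1) ^+ N * (p * q))%:C = (-1) ^+ N * (p%:C * q%:C).
  by rewrite !rmorphM rmorphXn rmorphN1.
pose cs (b : bool) (j : 'I_m) : R * R := if b then c1vec t j else c0vec t j.
rewrite /pfun.
transitivity (\sum_(s : {ffun 'I_m -> bool}) \sum_(mm <- msupp f) \sum_(0 <= k < (degree f).+1)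
   \sum_(kv : {ffun 'I_m -> 'I_k.+1} | (\sum_j kv j == k)%N)
   f@_mm * ((-1) ^+ k / (4 * pi) ^+ k)%:C *
    (\prod_j ((-1) ^+ s j * ((kv j)`!%:R^-1 
      * phi (kv j) (cs (s j) j) (expl mm j) (expr mm j) (x j))))%:C).
  apply: eq_bigr => s _.
  rewrite exchange_big mulr_sumr; apply: eq_bigr => k _ /=.
  rewrite exchange_big !mulr_sumr; apply: eq_bigr => kv _ /=.
  rewrite eval_Dcs !mulr_sumr; apply: eq_bigr => mm _ /=.
  (* The sign is distributed over the variables, so that the j-th factor depends on s only through s
     j. *)
  rewrite [X in _ = _ * X%:C](_ : _ = (-1) ^+ (\sum_j s j)%N
     * ((\prod_j ((kv j)`!%:R^-1 * derive1n (kv j) E (zarg (cs (s j) j) (x j))))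
     * \prod_j Dmono (kv j) (cs (s j) j) (expl mm j) (expr mm j) (x j))); last first.
    by rewrite -prodrXr -!big_split /=; apply: eq_bigr => j _; rewrite /phi !mulrA.
  by rewrite PQ /zarg; exact: shuffle.
rewrite exchange_big; apply: eq_bigr => mm _ /=.
rewrite exchange_big; apply: eq_bigr => k _ /=.
rewrite exchange_big; apply: eq_bigr => kv _ /=.
rewrite -mulr_sumr; congr (_ * _); rewrite -raddf_sum; congr (_%:C).
pose A (j : 'I_m) (b : bool) : R := (-1) ^+ b * ((kv j)`!%:R^-1 
  * phi (kv j) (cs b j) (expl mm j) (expr mm j) (x j)).
rewrite -(bigA_distr_bigA A); apply: eq_bigr => j _.
by rewrite big_bool /A /cs /dphi /c0vec /c1vec /= expr0 expr1; ring.
Qed.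
End Expansion.

(** * The limit *)

Section ComplexExponential.
Context {R : realType}.
Implicit Types z w : R[i].

Lemma cexpD z w : cexp (z + w) = cexp z * cexp w.
Proof.
rewrite /cexp !raddfD /= expRD rmorphM mulrACA; congr (_ * _).
by apply/eqP; rewrite eq_complex /= cosD sinD; apply/andP; split; apply/eqP; ring.
Qed.

Lemma cexp0 : cexp 0 = 1 :> R[i].
Proof. by rewrite /cexp /= expR0 cos0 sin0 mul1r. Qed.

Lemma cexp_sum (J : Type) (r : seq J) (F : J -> R[i]) :
  cexp (\sum_(j <- r) F j) = \prod_(j <- r) cexp (F j).
Proof. exact: (big_morph _ cexpD cexp0). Qed.

Lemma cmod_cexp z : cmod (cexp z) = expR (complex.Re z).
Proof.
rewrite /cexp cmodM cmodR ger0_norm ?expR_ge0// [X in _ * X](_ : _ = 1) ?mulr1//.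
by rewrite /cmod normc_def /= cos2Dsin2 sqrtr1.
Qed.

Lemma cmod_cexp_phase (x : R) : cmod (cexp (x%:C * 'i%C)) = 1.
Proof. by rewrite cmod_cexp ReiNIm /= oppr0 expR0. Qed.

Lemma cmod_qpow (tau : R[i]) (c : R) : cmod (qpow tau c) = expR (- (2 * pi * c * complex.Im tau)).
Proof.
rewrite /qpow cmod_cexp; congr expR; case: tau => u v /=.
by ring.
Qed.

Lemma cexp_pi_int (k : int) : cexp ((pi * k%:~R)%:C * 'i%C) = (-1) ^ k :> R[i].
Proof.
have nat_case (n : nat) : cexp ((pi * n%:R)%:C * 'i%C) = (-1) ^+ n :> R[i].
  elim: n => [|n IH]; first by rewrite mulr0 mul0r cexp0.
  rewrite -natr1 mulrDr mulr1 rmorphD mulrDl cexpD IH exprSr; congr (_ * _).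
  rewrite /cexp ReiNIm ImiRe /= oppr0 expR0 cospi sinpi mul1r.
  by apply/eqP; rewrite eq_complex /= oppr0 !eqxx.
case: k => n; first exact: nat_case.
rewrite NegzE mulrNz mulrN rmorphN mulNr.
have := cexpD (- ((pi * n.+1%:R)%:C * 'i%C)) ((pi * n.+1%:R)%:C * 'i%C : R[i]).
rewrite addNr cexp0 nat_case => /esym H.
have u : (-1) ^+ n.+1 \is a @GRing.unit R[i] by rewrite unitrX// unitrN1.
by apply: (mulIr u); rewrite H -exprnN mulVr.
Qed.

(** The source of the factor i^m in front of [KW]. *)
Lemma cexp_half_int (k : int) : cexp ((pi * (k%:~R + 2^-1))%:C * 'i%C) = 'i%C * (-1) ^ k :> R[i].
Proof.
rewrite mulrDr rmorphD mulrDl cexpD cexp_pi_int mulrC; congr (_ * _).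
rewrite /cexp ReiNIm ImiRe /= oppr0 expR0 mul1r cos_pihalf sin_pihalf.
by apply/eqP; rewrite eq_complex /= !eqxx.
Qed.

End ComplexExponential.

(** * Termwise approximation of complex functions on the lattice *)

Section Approximation.
Context {R : realType} {m : nat}.
Local Notation idx := {ffun 'I_m -> int * int}.
Implicit Types (T U : R -> idx -> R[i]) (S V : idx -> R[i]).

Definition capprox T S : Prop :=
  exists2 C : R, 0 <= C & exists2 k : R, 0 < k & forall n,
    cmod (S n) <= C * Gm k n
    /\ forall t, 0 < t <= 1 -> cmod (T t n - S n) <= t * (C * Gm k n).

Lemma capprox0 : capprox (fun _ _ => 0) (fun=> 0).
Proof.
have c0 : cmod (0 : R[i]) = 0 by rewrite -(rmorph0 (real_complex R)) cmodR normr0.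
exists 0 => //; exists 1 => // n; rewrite mul0r c0; split=> // t _.
by rewrite subrr c0 mulr0.
Qed.

Lemma capproxD T S U V : capprox T S -> capprox U V ->
  capprox (fun t n => T t n + U t n) (fun n => S n + V n).
Proof.
move=> [C C0 [k k0 H]] [D D0 [l l0 K]].
exists (C + D); first exact: addr_ge0.
exists (Num.min k l) => [|n]; first by rewrite lt_min k0.
have gk : Gm k n <= Gm (Num.min k l) n by apply: le_Gm; rewrite ge_min lexx.
have gl : Gm l n <= Gm (Num.min k l) n by apply: le_Gm; rewrite ge_min lexx orbT.
have [H1 H2] := H n; have [K1 K2] := K n.
have sum_le : C * Gm k n + D * Gm l n <= (C + D) * Gm (Num.min k l) n.
  by rewrite mulrDl; apply: lerD; apply: ler_wpM2l.
split=> [|t t01].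
  exact: le_trans (cmodD _ _) (le_trans (lerD H1 K1) sum_le).
have [t0 _] := andP t01.
rewrite opprD addrACA (le_trans (cmodD _ _))// (le_trans (lerD (H2 t t01) (K2 t t01)))//.
by rewrite -mulrDr ler_pM2l.
Qed.

Lemma capprox_sum (J : Type) (r : seq J) (P : pred J) 
    (T : J -> R -> idx -> R[i]) (S : J -> idx -> R[i]) :
  (forall j, P j -> capprox (T j) (S j)) ->
  capprox (fun t n => \sum_(j <- r | P j) T j t n) (fun n => \sum_(j <- r | P j) S j n).
Proof.
move=> H; elim: r => [|j r IH].
  rewrite [X in capprox X](_ : _ = fun _ _ => 0); last first.
    by apply/funext => t; apply/funext => n; rewrite big_nil.
  rewrite [X in capprox _ X](_ : _ = fun=> 0); first exact: capprox0.
  by apply/funext => n; rewrite big_nil.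
rewrite [X in capprox X](_ : _ = fun t n => (if P j then T j t n else 0) 
  + \sum_(i <- r | P i) T i t n); last first.
  by apply/funext => t; apply/funext => n; rewrite big_cons; case: ifP => //; rewrite add0r.
rewrite [X in capprox _ X](_ : _ = fun n => (if P j then S j n else 0) 
  + \sum_(i <- r | P i) S i n); last first.
  by apply/funext => n; rewrite big_cons; case: ifP => //; rewrite add0r.
apply: capproxD => //.
by have [Pj|_] := boolP (P j); [exact: H|exact: capprox0].
Qed.

Lemma approx1Zl (c : R) (F : R -> int * int -> R) (F0 w : int * int -> R) :
  approx1 (fun t n => F t n * w n) (fun n => F0 n * w n) ->
  approx1 (fun t n => c * F t n * w n) (fun n => c * F0 n * w n).
Proof.
move=> [C C0 [k k0 H]]; exists (`|c| * C); first exact: mulr_ge0.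
exists k => // n; have [H1 H2] := H n.
split=> [|t t01]; first by rewrite -mulrA normrM -mulrA ler_wpM2l.
rewrite -2!mulrA -mulrBr normrM [leRHS](_ : _ = `|c| * (t * (C * G1 k n))); last by ring.
by rewrite ler_wpM2l// H2.
Qed.

(** Only the modulus of W matters. It splits over the variables, and each F j is controlled only
    together with its own weight w j. *)
Lemma capprox_prod (z : R[i]) (W : idx -> R[i]) (F : 'I_m -> R -> int * int -> R)
    (F0 : 'I_m -> int * int -> R) (w : 'I_m -> int * int -> R) :
  (forall n, cmod (W n) = \prod_j w j (n j)) ->
  (forall j n, 0 <= w j n) ->
  (forall j, approx1 (fun t n => F j t n * w j n) (fun n => F0 j n * w j n)) ->
  capprox (fun t n => z * (\prod_j F j t (n j))%:C * W n)
         (fun n => z * (\prod_j F0 j (n j))%:C * W n).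
Proof.
move=> Ww w0 /approx1_prod [C C0 [k k0 H]].
exists (cmod z * C); first by rewrite mulr_ge0 ?cmod_ge0.
exists k => // n; have [H1 H2] := H n.
have W0 : 0 <= \prod_j w j (n j) by apply: prodr_ge0.
split=> [|t t01].
  rewrite !cmodM cmodR Ww -!mulrA ler_wpM2l ?cmod_ge0//.
  by rewrite -{1}[X in _ * X](ger0_norm W0) -normrM -big_split.
rewrite -mulrBl -mulrBr -rmorphB !cmodM cmodR Ww.
rewrite [leRHS](_ : _ = cmod z * (t * (C * Gm k n))); last by ring.
rewrite -mulrA ler_wpM2l ?cmod_ge0//.
rewrite -[X in _ * X](ger0_norm W0) -normrM mulrBl -!big_split; exact: H2.
Qed.

End Approximation.

(** * The limit for a homogeneous polynomial *)

Section Limit.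
Context {R : realType} {m : nat}.
Local Notation idx := {ffun 'I_m -> int * int}.
Implicit Types (f : {mpoly R[i][(m + m)%N]}) (x : 'I_m -> R * R).
Local Notation expl mm := (fun j : 'I_m => mm (lshift m j)).
Local Notation expr mm := (fun j : 'I_m => mm (rshift m j)).

Lemma Q1_scale (r : R) (y : R * R) : Q1 (r * y.1, r * y.2) = r ^+ 2 * Q1 y.
Proof. by rewrite /Q1 /=; ring. Qed.

Lemma sgnprod_scale (r : R) x : 0 < r -> sgnprod (scalev r x) = sgnprod x.
Proof.
move=> r0; apply: eq_bigr => j _; rewrite /scalev /=.
have -> : r * (x j).1 - r * (x j).2 = r * ((x j).1 - (x j).2) by ring.
have -> : - (r * (x j).1) - r * (x j).2 = r * (- (x j).1 - (x j).2) by ring.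
by rewrite !sgrM (gtr0_sg r0) !mul1r.
Qed.

Lemma evalp_scale (d : nat) f (r : R) x : f \is d.-homog for mdeg ->
  evalp f (scalev r x) = (r ^+ degree f)%:C * evalp f x.
Proof.
(* [degree] is read off [msize], so homogeneity is restated with that exponent. *)
move=> /dhomog_msize/dhomogP fd; rewrite !evalpE mulr_sumr !big_seq.
apply: eq_bigr => mm mmf; rewrite mulrCA -rmorphM; congr (_ * _%:C).
have -> : degree f = mdeg mm by rewrite (fd _ mmf).
rewrite mdegE big_split_ord.
rewrite [X in _ = _ ^+ X * _](_ : _ = \sum_(j < m) (expl mm j + expr mm j))%N; last by rewrite big_split.
rewrite -prodrXr -big_split; apply: eq_bigr => j _ /=.
by rewrite !exprMn exprD; ring.
Qed.

(** For k > 0 some k_j is positive and its factor vanishes; k = 0 leaves only the zero tuple. *)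
Lemma dphi_lim_collapse (D : nat) (z : R[i]) (a b : 'I_m -> nat) x :
  \sum_(0 <= k < D.+1) \sum_(kv : {ffun 'I_m -> 'I_k.+1} | (\sum_j kv j == k)%N)
    z * ((-1) ^+ k / (4 * pi) ^+ k)%:C
      * (\prod_j (((kv j)`!)%:R^-1 * dphi_lim (kv j) (a j) (b j) (x j)))%:C
  = z * (sgnprod x * \prod_j ((x j).1 ^+ a j * (x j).2 ^+ b j))%:C.
Proof.
rewrite big_nat_recl// [X in _ + X]big1 ?addr0 => [|k _]; last first.
  apply: big1 => kv /eqP kvk.
  have [j kvj] : exists j, kv j != 0%N :> nat.
    apply/existsP; rewrite -negb_forall; apply/negP => /forallP kv0.
    by move: kvk; rewrite big1 // => j _; apply/eqP; exact: kv0.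
  by rewrite (bigD1 j)//= /dphi_lim (negPf kvj) mul0r mulr0 mul0r mulr0.
rewrite (big_pred1 [ffun=> ord0]) => [|kv /=]; last first.
  apply/eqP/eqP => [_|->]; first by apply/ffunP => j; rewrite ffunE ord1.
  by rewrite big1// => j _; rewrite ffunE.
rewrite !expr0 divr1 mulr1 /sgnprod -big_split; congr (_ * _%:C).
by apply: eq_bigr => j _; rewrite ffunE /dphi_lim /= invr1 !mul1r.
Qed.

Lemma theta_approx (d : nat) f (a b : 'I_m -> R * R) (tau : R[i]) :
  f \is d.-homog for mdeg ->
  (forall j, B1 (1, 1) (a j) \isn't a Num.int /\ B1 (-1, 1) (a j) \isn't a Num.int) ->
  0 < complex.Im tau ->
  let v := complex.Im tau in
  capprox
    (fun t (n : idx) => let x := latt a n in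
      pfun (@c0vec R m t) (@c1vec R m t) f (scalev (Num.sqrt v) x) * qpow tau (Qm x)
        * cexp ((2 * pi * Bm x b)%:C * 'i%C))
    (fun n => (Num.sqrt v ^+ degree f)%:C * sgn_term a b f tau n).
Proof.
move=> fd anint v0 v; have sv0 : 0 < Num.sqrt v by rewrite sqrtr_gt0.
pose W (n : idx) := qpow tau (Qm (latt a n)) * cexp ((2 * pi * Bm (latt a n) b)%:C * 'i%C).
pose X (j : 'I_m) (n : int * int) := (Num.sqrt v * ((a j).1 + n.1%:~R),
  Num.sqrt v * ((a j).2 + n.2%:~R)).
(* G is [dphi] or [dphi_lim]. The limit is written as the same sum, though most of its terms vanish,
   so that the comparison can be made term by term. *)
pose F (G : R -> nat -> nat -> nat -> R * R -> R) := fun t (n : idx) =>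
  \sum_(mm <- msupp f) \sum_(0 <= k < (degree f).+1)
      \sum_(kv : {ffun 'I_m -> 'I_k.+1} | (\sum_j kv j == k)%N)
      f@_mm * ((-1) ^+ k / (4 * pi) ^+ k)%:C *
       (\prod_j (((kv j)`!)%:R^-1 * G t (kv j) (expl mm j) (expr mm j) (X j (n j))))%:C * W n.
have FE (G : R -> nat -> nat -> nat -> R * R -> R) t n : F G t n =
   (\sum_(mm <- msupp f) \sum_(0 <= k < (degree f).+1)
      \sum_(kv : {ffun 'I_m -> 'I_k.+1} | (\sum_j kv j == k)%N)
      f@_mm * ((-1) ^+ k / (4 * pi) ^+ k)%:C *
       (\prod_j (((kv j)`!)%:R^-1 * G t (kv j) (expl mm j) (expr mm j) (X j (n j))))%:C) * W n.
  rewrite mulr_suml; apply: eq_bigr => mm _; rewrite mulr_suml; apply: eq_bigr => k _.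
  by rewrite mulr_suml; apply: eq_bigr.
rewrite [X in capprox X](_ : _ = F (fun t l => dphi l t)); last first.
  by apply/funext => t; apply/funext => n; rewrite FE -pfun_expand mulrA.
rewrite [X in capprox _ X](_ : _ = F (fun _ => dphi_lim) 0); last first.
  apply/funext => n; rewrite FE /sgn_term.
  under eq_bigr do rewrite dphi_lim_collapse.
  set y := latt a n.
  have shuffle (K : comPzRingType) (e p r' q z : K) : e * (p * r' * q * z) = p * (e * r') * (q * z).
    by ring.
  rewrite shuffle -(sgnprod_scale y sv0) -(evalp_scale _ _ fd); congr (_ * _).
  rewrite evalpE mulr_sumr; apply: eq_bigr => mm _.
  by rewrite rmorphM mulrCA.
apply: (@capprox_sum _ _ _ _ _ (fun mm t n => _) (fun mm n => _)) => mm _.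
apply: (@capprox_sum _ _ _ _ _ (fun k t n => _) (fun k n => _)) => k _.
apply: (@capprox_sum _ _ _ _ _ (fun kv t n => _) (fun kv n => _)) => kv _.
apply: (@capprox_prod _ _ _ W
  (fun j t n => ((kv j)`!)%:R^-1 * dphi (kv j) t (expl mm j) (expr mm j) (X j n))
  (fun j n => ((kv j)`!)%:R^-1 * dphi_lim (kv j) (expl mm j) (expr mm j) (X j n))
  (fun j n => gq (X j n))).
- move=> n; rewrite /W cmodM cmod_qpow cmod_cexp_phase mulr1 /gq -expR_sum.
  rewrite /Qm mulr_sumr mulr_suml -sumrN; congr expR; apply: eq_bigr => j _.
  have := Q1_scale (Num.sqrt v) (latt a n j); rewrite sqr_sqrtr; last exact: ltW.
  by rewrite /X /latt /= => ->; ring.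
- by move=> j n; exact: expR_ge0.
- move=> j; have [a1 a2] := anint j; apply: approx1Zl.
  exact: (dphi_lattice_approx _ _ _ sv0 a1 a2).
Qed.

Lemma theta_limit (d : nat) f (a b : 'I_m -> R * R) (tau : R[i]) :
  f \is d.-homog for mdeg ->
  (forall j, B1 (1, 1) (a j) \isn't a Num.int /\ B1 (-1, 1) (a j) \isn't a Num.int) ->
  0 < complex.Im tau ->
  (exists M : R, forall A,
     summability.partial_sum (fun n => cmod (sgn_term a b f tau n)) A <= M)
  /\ theta (@c0vec R m t) (@c1vec R m t) a b f tau @[t --> 0^'+]
       --> csum (sgn_term a b f tau).
Proof.
move=> fd anint v0; have [C C0 [k k0 H]] := theta_approx b fd anint v0.
have [M HM] := @Gm_bounded R m k k0.
set v := complex.Im tau in v0 H *.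
have sv0 : 0 < Num.sqrt v by rewrite sqrtr_gt0.
set D := degree f in H.
(* The normalization in [theta], inverse to the factor produced by homogeneity. *)
pose z : R[i] := (v `^ (- (D%:R / 2)))%:C.
have zr : z * (Num.sqrt v ^+ D)%:C = 1.
  rewrite -rmorphM -powR12_sqrt ?ltW// -powR_mulrn ?powR_ge0// -powRrM -powRD.
    by rewrite [2^-1 * _]mulrC addNr powRr0.
  by apply/implyP => _; rewrite gt_eqF.
have GM (A : {fset idx}) : summability.partial_sum (fun n => C * Gm k n) A <= C * M.
  by rewrite psumE -mulr_sumr ler_wpM2l// -psumE.
have HS (A : {fset {ffun 'I_m -> int * int}}) :
    summability.partial_sum (fun n => cmod ((Num.sqrt v ^+ D)%:C * sgn_term a b f tau n)) A
      <= C * M.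
  by apply: le_trans (GM A); rewrite !psumE; apply: ler_sum => n _; exact: (H n).1.
have sE : sgn_term a b f tau = fun n => z * ((Num.sqrt v ^+ D)%:C * sgn_term a b f tau n).
  by apply/funext => n; rewrite mulrA zr mul1r.
split.
  exists (cmod z * (C * M)) => A; rewrite sE psumE.
  under eq_bigr do rewrite cmodM.
  by rewrite -mulr_sumr ler_wpM2l ?cmod_ge0// -psumE.
rewrite sE (csumZ _ HS); apply: (@cvgZr _ (R[i]^o)).
apply: (csum_cvg_at_right GM) => [n|t n t01]; first exact: (H n).1.
exact: (H n).2.
Qed.

End Limit.

(** * Specialization to V_m and KW_m *)

Section Vandermonde.
Context {R : realType} {m : nat}.
Local Notation idx := {ffun 'I_m -> int * int}.

Lemma prod_homog (J : Type) (r : seq J) (P : pred J) (F : J -> {mpoly R[i][(m + m)%N]}) :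
  (forall j, P j -> exists d, F j \is d.-homog for mdeg) ->
  exists d, \prod_(j <- r | P j) F j \is d.-homog for mdeg.
Proof.
move=> FH; apply: (big_ind (fun p => exists d, p \is d.-homog for mdeg)) => //.
  by exists 0%N; exact: dhomog1.
by move=> p q [d pd] [e qe]; exists (d + e)%N; exact: dhomogM.
Qed.

Lemma Vpoly_homog : exists d, @Vpoly R m \is d.-homog for mdeg.
Proof.
have X1 (i : 'I_(m + m)) : ('X_i : {mpoly R[i][(m + m)%N]}) \is 1%N.-homog for mdeg.
  by rewrite dhomogX; apply/eqP; exact: mdeg1.
have sq (i j : 'I_(m + m)) : ('X_i ^+ 2 - 'X_j ^+ 2 : {mpoly R[i][(m + m)%N]})
    \is 2%N.-homog for mdeg.
  by apply: rpredB; exact: (dhomogMn 2 (X1 _)).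
have [d1 H1] : exists d, (\prod_(i < m) \prod_(j < m | (i < j)%N)
   (('X_(lshift m i) ^+ 2 - 'X_(lshift m j) ^+ 2) * ('X_(rshift m i) ^+ 2 - 'X_(rshift m j) ^+ 2))
   : {mpoly R[i][(m + m)%N]}) \is d.-homog for mdeg.
  by apply: prod_homog => i _; apply: prod_homog => j _; exists 4%N;
    exact: (dhomogM (sq _ _) (sq _ _)).
have [d2 H2] : exists d, (\prod_(j < m) ('X_(lshift m j) * 'X_(rshift m j))
   : {mpoly R[i][(m + m)%N]}) \is d.-homog for mdeg.
  by apply: prod_homog => j _; exists 2%N; exact: (dhomogM (X1 _) (X1 _)).
by exists (d1 + d2)%N; exact: dhomogM H1 H2.
Qed.

(** -1/2 is the value at (0, 1/2) of B_1 with either of (1, 1) and (-1, 1). *)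
Lemma half_notint : (- 2^-1 : R) \isn't a Num.int.
Proof.
apply/negP => /intrP[z hz].
have z0 : z < 0 by rewrite -(ltr_int R) -hz oppr_lt0 invr_gt0.
have : (-1 < z)%R by rewrite -(ltr_int R) -hz mulrN1z ltrN2 invf_lt1// ltr1n.
by rewrite -lezD1 addNr leNgt z0.
Qed.

(** The phase of one variable is e^{pi i (x_j - y_j)}, and x_j - y_j exceeds the integer exponent of
    -1 by 1/2, which yields one factor i per variable. *)
Lemma KW_term (tau : R[i]) (n : idx) :
  sgn_term (fun=> (0, 2^-1)) (fun=> (2^-1, 2^-1)) (Vpoly m) tau n
  = 'i%C ^+ m *
    (let x (j : 'I_m) : R * R := ((n j).1%:~R, (n j).2%:~R + 2^-1) in
    (sgnprod x)%:C * evalp (Vpoly m) x *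
    \prod_j (qpow tau (2^-1 * ((x j).1 ^+ 2 - (x j).2 ^+ 2))
             * (-1) ^ ((n j).1 - (n j).2 - 1))).
Proof.
rewrite /sgn_term.
have -> : latt (fun=> (0, 2^-1)) n
  = fun j => ((n j).1%:~R, (n j).2%:~R + 2^-1) :> R * R.
  by apply/funext => j; rewrite /latt /= add0r addrC.
set x := (fun j => _).
have shuffle (K : comPzRingType) (y q p z w : K) : q * p = z * w -> y * q * p = z * (y * w).
  by move=> h; rewrite -mulrA h mulrCA.
apply: shuffle.
have -> : qpow tau (Qm x) = \prod_j qpow tau (2^-1 * ((x j).1 ^+ 2 - (x j).2 ^+ 2)).
  by rewrite /qpow /Qm mulr_sumr raddf_sum !mulr_suml cexp_sum.
have -> : cexp ((2 * pi * Bm x (fun=> (2^-1, 2^-1)))%:C * 'i%C)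
    = \prod_j ('i%C * (-1) ^ ((n j).1 - (n j).2 - 1)).
  rewrite /Bm mulr_sumr raddf_sum mulr_suml cexp_sum; apply: eq_bigr => j _ /=.
  rewrite -cexp_half_int; apply: (congr1 (fun r : R => cexp (r%:C * 'i%C))).
  by rewrite /B1 /x /= !intrB; field.
by rewrite !big_split /= prodr_const card_ord mulrCA.
Qed.

End Vandermonde.


Theorem theorem5p7 (R : realType) (m : nat) (hm : (1 <= m)%N) :
  (forall (t : R) (j : 'I_m), 0 < t ->
     c0vec t j \in cone /\ c1vec t j \in cone)
  /\
  (forall (d : nat) (f : {mpoly R[i][(m + m)%N]}), spherical d f ->
   forall a : 'I_m -> R * R,
     (forall j, B1 (1, 1) (a j) \isn't a Num.int
                /\ B1 (-1, 1) (a j) \isn't a Num.int) ->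
   forall (b : 'I_m -> R * R) (tau : R[i]), 0 < complex.Im tau ->
     abs_summable (sgn_term a b f tau)
     /\ theta (@c0vec R m t) (@c1vec R m t) a b f tau @[t --> 0^'+]
          --> csum (sgn_term a b f tau))
  /\
  (forall tau : R[i], 0 < complex.Im tau ->
     theta (@c0vec R m t) (@c1vec R m t)
       (fun=> (0, 2^-1)) (fun=> (2^-1, 2^-1)) (Vpoly m) tau @[t --> 0^'+]
       --> ((4 * 'i%C) ^+ m * (m`!)%:R
            * (\prod_(1 <= j < m.+1) ((2 * j - 1)`!)%:R) ^+ 2
            * KW m tau : R[i]^o)).
Proof.
split; [|split].
- move=> t j t0; rewrite !inE /cone /c0vec /c1vec /= /Q1 /=.
  have : 0 < t * t by exact: mulr_gt0.
  by move=> tt; split; split; rewrite ?expr2; nra.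
- move=> d f [fd _] a anint b tau v0.
  have [[M HM] lim] := theta_limit b fd anint v0.
  by split=> //; exact: abs_summable_bounded HM.
- move=> tau v0; have [d Vd] := @Vpoly_homog R m.
  pose y : R * R := (0, 2^-1); pose z : R * R := (2^-1, 2^-1).
  have [|[M HM] lim] := @theta_limit R m d (Vpoly m) (fun=> y) (fun=> z) tau Vd _ v0.
    by move=> j; rewrite /B1 /= !mulr0 !mul1r !sub0r half_notint.
  set K := (X in _ --> X); suff -> : K = csum (sgn_term (fun=> y) (fun=> z) (Vpoly m) tau) by [].
  have tE : sgn_term (fun=> y) (fun=> z) (Vpoly m) tau = _ := funext (KW_term tau).
  (* Hence M also bounds the series without the factor i^m, as [csumZ] requires. *)
  have ci : cmod ('i%C ^+ m : R[i]) = 1.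
    by rewrite /cmod normrX normc_def /= expr0n expr1n add0r sqrtr1 expr1n.
  rewrite tE (csumZ (M := M)) => [|A]; last first.
    apply: le_trans (HM A); rewrite !psumE; apply: ler_sum => n _.
    by rewrite KW_term [leRHS]cmodM ci mul1r.
  (* With c = 4^m and e = i^m, the prefactor of [KW] cancels all but i^m. *)
  have simp (L : fieldType) (c e F Q S : L) : c != 0 -> F * Q != 0 ->
      c * e * F * Q * (c^-1 * (F * Q)^-1 * S) = e * S.
    by rewrite mulf_eq0 negb_or => c0 /andP[F0 Q0]; field; rewrite c0 F0 Q0.
  rewrite /K /KW exprMn; apply: simp; first by rewrite expf_neq0// pnatr_eq0.
  rewrite mulf_neq0// ?expf_neq0// ?pnatr_eq0 -?lt0n ?fact_gt0//.
  elim/big_ind: _ => [|p q p0 q0|j _]; rewrite ?oner_eq0 ?mulf_neq0//.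
Qed.
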